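(* There is an integer $D\ge 1$ such that, for every fixed integer $d\ge D$, as $n\to\infty$ over integers with $dn$ even, a.a.s. $\mathrm{sp}(G(n,d))=\lceil\log_2 n\rceil$.
   Context: A family of subsets $V_1,\dots,V_k$ of a set $V$ is a separating system of $V$ if for every two distinct $u,v\in V$ there is $i$ with $|V_i\cap\{u,v\}|=1$. For a graph $G$, $\mathrm{sp}(G)$ is the minimum size of a family $\mathcal P$ of paths in $G$ (single-vertex paths allowed) such that $\{V(P):P\in\mathcal P\}$ is a separating system of $V(G)$. $G(n,d)$ is a uniformly random $d$-regular graph on $n$ vertices. A.a.s. means with probability tending to $1$ as $n\to\infty$. *)

(* Defs.v *)
From HB Require Import structures.
From mathcomp Require Import all_boot all_order all_algebra.
Set Implicit Arguments. Unset Strict Implicit. Unset Printing Implicit Defensive.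

Definition graph (n : nat) := {ffun 'I_n * 'I_n -> bool}.

Definition adj n (g : graph n) : rel 'I_n := fun x y => g (x, y).

Definition simple_graph n (g : graph n) : bool :=
  [forall x, ~~ adj g x x] && [forall x, forall y, adj g x y == adj g y x].

Definition regular n (d : nat) (g : graph n) : bool :=
  simple_graph g && [forall x, #|[set y | adj g x y]| == d].

Definition is_gpath n (g : graph n) (s : seq 'I_n) : bool :=
  if s is x :: s' then path (adj g) x s' && uniq s else false.

(* S is the vertex set V(P) of some path P in g (such P has #|S| vertices) *)
Definition is_path_set n (g : graph n) (S : {set 'I_n}) : bool :=
  [exists t : (#|S|).-tuple 'I_n, is_gpath g t && ([set x in t] == S)].

Definition separating n (F : seq {set 'I_n}) : bool :=
  [forall u : 'I_n, forall v : 'I_n, (u != v) ==> has (fun V : {set 'I_n} => (u \in V) != (v \in V)) F].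

Definition has_sps n (g : graph n) (k : nat) : bool :=
  [exists F : k.-tuple {set 'I_n}, all (is_path_set g) F && separating F].

Definition sp_eq n (g : graph n) (m : nat) : bool :=
  has_sps g m && [forall k : 'I_m, ~~ has_sps g k].

Definition reg_graphs n d : {set graph n} := [set g | regular d g].

Definition prob_reg n d (P : pred (graph n)) : rat :=
  (#|[set g in reg_graphs n d | P g]|%:R / #|reg_graphs n d|%:R)%R.
Arguments prob_reg n d P : clear implicits.
Arguments reg_graphs n d : clear implicits.

(* Main.v *)
Require Import Defs.
From HB Require Import structures.
From mathcomp Require Import all_boot all_order all_algebra.
From mathcomp Require Import boolp.
From mathcomp Require Import zify.
Import Order.TTheory GRing.Theory Num.Theory.
Set Implicit Arguments. Unset Strict Implicit. Unset Printing Implicit Defensive.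

(** A family of k sets separates n points only if n <= 2^k.  Conversely, the
    ceil(log2 n) paths are found one after the other: pair up the vertices
    inside the classes not yet separated; a path meeting every pair in exactly
    one vertex halves all classes.  So it suffices that a.a.s. for EVERY pairing
    of the vertices some path contains exactly one vertex of each pair.

    Given a pairing, the local lemma yields a transversal T in which every vertex
    of G keeps a positive fraction of its neighbours.  A sparse subgraph F of
    G[T], made of a few neighbours per vertex together with a greedy hitting set
    that joins any two linear-sized sets, is an expander.  By Posa's rotations,
    every expander has quadratically many pairs of end vertices of longest paths
    (boosters); a.a.s. G contains a booster of every such sparse F, and adding
    boosters one at a time produces a Hamilton path of G[T].

    The probabilistic input is obtained by edge switchings in the set of simple
    d-regular graphs: containing one more prescribed edge costs a factor 2d/n, and
    avoiding a quadratic set of pairs has probability exp(-c d n), even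
    conditionally on containing a given sparse graph. *)

(** * Switchings of regular graphs *)

(** There are more than exponentially many pairings, too many for a union bound against exp(-c d n)
    with d fixed. Hence no random property mentions a pairing: they are stated for vertex sets, of
    which there are only 2^n, and for sparse edge sets. Once these properties hold, the rest is
    deterministic.

    Sparseness of F is forced by the same union bound. The expected number of sets of f = 7rn edges
    in G is at most exponential in f with base of order d/r. For r about d/K this costs (8K)^f,
    while missing all boosters of one F has probability at most 4^(-krn). The constant k is chosen
    to beat the cost, and then K is taken so large that krn is a small fraction of dn, which is what
    the switchings can deliver.

    Sets of graphs are counted and all estimates are multiplied out; probabilities appear only in
    the final theorem. The bound on the failure probability is of order 1/n because of
    [sparse_small]; the other two events are exponentially unlikely to fail. *)

Lemma card_pairs (A B : finType) (P : A -> B -> bool) :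
  #|[set p : A * B | P p.1 p.2]| = \sum_(a : A) #|[set b | P a b]|.
Proof.
rewrite -sum1_card.
rewrite (eq_bigl (fun p : A * B => P p.1 p.2)); last by move=> p; rewrite inE.
rewrite -(pair_big_dep xpredT P (fun _ _ => 1)) /=; apply: eq_bigr => a _.
by rewrite -sum1_card; apply: eq_bigl => b; rewrite inE.
Qed.

Lemma card_fibers (A B : finType) (P : {set A}) (R : A -> {set B}) :
  #|[set p : A * B | (p.1 \in P) && (p.2 \in R p.1)]| = \sum_(a in P) #|R a|.
Proof.
rewrite (card_pairs (fun a b => (a \in P) && (b \in R a))) [RHS]big_mkcond /=.
apply: eq_bigr => a _; case: (a \in P) => /=.
  by apply: eq_card => b; rewrite inE.
by apply/eqP; rewrite cards_eq0; apply/eqP/setP=> b; rewrite !inE.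
Qed.

Lemma card_fibers_const (A B : finType) (P : {set A}) (R : A -> {set B}) l :
  (forall a, a \in P -> #|R a| = l) ->
  #|[set p : A * B | (p.1 \in P) && (p.2 \in R p.1)]| = #|P| * l.
Proof. by move=> h; rewrite card_fibers -sum_nat_const; apply: eq_bigr. Qed.

(** Here [b] is the data of a switching. Keeping it beside the image makes (a, b) -> (f a b, b)
    injective, so inverse switchings need no description; only the data possible at an image are
    bounded. *)
Lemma double_count (A B : finType) (X Y : {set A}) (P Q : A -> {set B})
    (f : A -> B -> A) (k l : nat) :
  (forall b, injective (f^~ b)) ->
  (forall a b, a \in X -> b \in P a -> f a b \in Y /\ b \in Q (f a b)) ->
  (forall a, a \in X -> k <= #|P a|) -> (forall a, a \in Y -> #|Q a| <= l) ->
  #|X| * k <= #|Y| * l.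
Proof.
move=> finj fP hk hl.
pose S := [set p : A * B | (p.1 \in X) && (p.2 \in P p.1)].
pose S' := [set p : A * B | (p.1 \in Y) && (p.2 \in Q p.1)].
have hSS' : #|S| <= #|S'|.
  have ginj : injective (fun p : A * B => (f p.1 p.2, p.2)).
    by move=> [a b] [a' b'] /= [] e1 e2; subst b'; rewrite (finj _ _ _ e1).
  rewrite -(card_imset _ ginj); apply: subset_leq_card; apply/subsetP=> q.
  case/imsetP=> -[a b]; rewrite inE /= => /andP[aX bP] ->.
  by rewrite inE /=; case: (fP _ _ aX bP) => -> ->.
apply: leq_trans (_ : #|S| <= _).
  rewrite card_fibers -sum_nat_const; apply: leq_sum => a; exact: hk.
apply: leq_trans hSS' _.
rewrite card_fibers -sum_nat_const; apply: leq_sum => a; exact: hl.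
Qed.

Lemma leq_card_cover4 (T : finType) (A P B1 B2 B3 B4 : {set T}) b1 b2 b3 b4 :
  A \subset P :|: (B1 :|: B2 :|: B3 :|: B4) ->
  #|B1| <= b1 -> #|B2| <= b2 -> #|B3| <= b3 -> #|B4| <= b4 ->
  #|A| <= #|P| + (b1 + b2 + b3 + b4).
Proof.
move=> /subset_leq_card h h1 h2 h3 h4; apply: leq_trans h _.
have hU (X Y : {set T}) : #|X :|: Y| <= #|X| + #|Y| by rewrite cardsU leq_subr.
apply: leq_trans (hU _ _) _; rewrite leq_add2l.
by do 3!(apply: leq_trans (hU _ _) _; apply: leq_add => //).
Qed.

Section Toggle.
Variable n : nat.
Implicit Types (g : graph n) (x y u w : 'I_n).

Definition edge_pair (a b : 'I_n) : pred ('I_n * 'I_n) :=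
  fun p => (p == (a, b)) || (p == (b, a)).

(** Exclusive or along the 4-cycle x y w u makes this injective in [g] for every [c], admissible or
    not. In [switchable] the edges of the cycle are alternately present and absent. *)
Definition switch g (c : ('I_n * 'I_n) * ('I_n * 'I_n)) : graph n :=
  let: ((x, u), (y, w)) := c in
  [ffun p => g p (+) edge_pair x y p (+) edge_pair y w p (+) edge_pair w u p (+) edge_pair u x p].

Definition switchable g x y w u := [&& x != u, y != w, g (x, y), ~~ g (y, w), g (w, u) & ~~ g (u,
  x)].

Lemma switch_inj c : injective (switch^~ c).
Proof.
case: c => [[x u] [y w]] g g' /ffunP e; apply/ffunP=> p; move: (e p); rewrite !ffunE.
by do 4 move/addIb.
Qed.

Lemma edge_pairC a b p q : edge_pair a b (p, q) = edge_pair a b (q, p).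
Proof. by rewrite /edge_pair !xpair_eqE; case: (p == a); case: (p == b); case: (q == a);
  case: (q == b). Qed.

Lemma simpleP g : simple_graph g ->
  (forall x, g (x, x) = false) * (forall x y, g (x, y) = g (y, x)).
Proof.
case/andP=> /forallP h1 /forallP h2; split=> x; first exact/negbTE/h1.
by move=> y; have /forallP /(_ y) /eqP := h2 x.
Qed.

(** Used at each vertex of the 4-cycle, which exchanges its neighbour [b] for [c]. *)
Lemma card_nbrs_switch g (a b c : 'I_n) (N' : {set 'I_n}) :
  g (a, b) -> ~~ g (a, c) -> b != c ->
  (forall z, (z \in N') = g (a, z) (+) (z == b) (+) (z == c)) ->
  #|N'| = #|[set z | adj g a z]|.
Proof.
move=> gb gc bc hN.
have -> : N' = c |: ([set z | adj g a z] :\ b).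
  apply/setP=> z; rewrite hN !inE /adj.
  case: (eqVneq z b) => [->|zb]; first by rewrite gb (negbTE bc).
  case: (eqVneq z c) => [->|zc]; first by rewrite (negbTE gc).
  by case: (g _).
rewrite cardsU1 !inE negb_and /adj (negbTE gc) orbT add1n.
by rewrite [RHS](cardsD1 b) inE /adj gb.
Qed.

Lemma switch_regular d g x y w u : regular d g -> switchable g x y w u ->
  regular d (switch g ((x, u), (y, w))).
Proof.
case/andP=> gs /forallP hd /and5P[xu yw gxy gyw /andP[gwu gux]].
have [girr gsym] := simpleP gs.
have xy : x != y by apply: contraTN gxy => /eqP->; rewrite girr.
have wu : w != u by apply: contraTN gwu => /eqP->; rewrite girr.
have xw : x != w by apply: contraNN gyw => /eqP <-; rewrite gsym.
have yu : y != u by apply: contraNN gux => /eqP <-; rewrite gsym.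
apply/andP; split.
  apply/andP; split; apply/forallP=> a.
    rewrite /adj ffunE girr /edge_pair !xpair_eqE /=.
    have F (b c : 'I_n) : b != c -> (a == b) && (a == c) = false.
      by move=> bc; apply: contraNF bc => /andP[/eqP <- /eqP <-].
    by rewrite !F // eq_sym.
  by apply/forallP=> b; rewrite /adj !ffunE gsym !(edge_pairC _ _ b a).
apply/forallP=> a; rewrite -(eqP (hd a)); apply/eqP.
have T z : (z \in [set z0 | adj (switch g ((x, u), (y, w))) a z0]) =
   g (a, z) (+) edge_pair x y (a, z) (+) edge_pair y w (a, z) (+) edge_pair w u (a, z) (+)
     edge_pair u x (a, z).
  by rewrite inE /adj ffunE.
have ee := eq_sym.
case: (eqVneq a x) => [ax|ax].
  subst a; apply: (@card_nbrs_switch _ _ y u) => //; first by rewrite gsym.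
  move=> z; rewrite T /edge_pair !xpair_eqE eqxx /= (negbTE xy) (negbTE xw) (negbTE xu) /=.
  by rewrite ?andbF ?orbF ?addbF.
case: (eqVneq a y) => [ay|ay].
  subst a; apply: (@card_nbrs_switch _ _ x w) => //; first by rewrite gsym.
  move=> z; rewrite T /edge_pair !xpair_eqE eqxx /= (ee _ y x) (negbTE xy) (negbTE yw) (negbTE
    yu) /=.
  by rewrite ?andbF ?orbF ?addbF.
case: (eqVneq a w) => [aw|aw].
  subst a; apply: (@card_nbrs_switch _ _ u y) => //; first by rewrite gsym. by rewrite ee.
  move=> z; rewrite T /edge_pair !xpair_eqE eqxx /= (ee _ w x) (negbTE xw) (ee _ w y) (negbTE yw)
    (negbTE wu) /=.
  by rewrite ?andbF ?orbF ?addbF; case: (g _); case: (z == y); case: (z == u).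
case: (eqVneq a u) => [au|au].
  subst a; apply: (@card_nbrs_switch _ _ w x) => //; first by rewrite gsym. by rewrite ee.
  move=> z; rewrite T /edge_pair !xpair_eqE eqxx /= (ee _ u x) (negbTE xu) (ee _ u y) (negbTE yu)
    (ee _ u w) (negbTE wu) /=.
  by rewrite ?andbF ?addbF ?orbF.
apply: eq_card => z; rewrite T inE /edge_pair !xpair_eqE /adj.
by rewrite (negbTE ax) (negbTE ay) (negbTE aw) (negbTE au) /= !addbF.
Qed.

End Toggle.

Section Counts.
Variables (n d : nat).
Implicit Types (g : graph n) (F B : {set 'I_n * 'I_n}).

Definition edges g : {set 'I_n * 'I_n} := [set p | g p].
Definition nbrs g x : {set 'I_n} := [set y | adj g x y].

Lemma card_nbrs g x : regular d g -> #|nbrs g x| = d.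
Proof. by case/andP=> _ /forallP /(_ x) /eqP. Qed.

Lemma edges_irr g x y : regular d g -> (x, y) \in edges g -> x != y.
Proof.
case/andP=> gs _; rewrite inE => h; apply: contraTneq h => ->.
by rewrite (simpleP gs).1.
Qed.

Lemma edges_sym g x y : regular d g -> ((x, y) \in edges g) = ((y, x) \in edges g).
Proof. by case/andP=> gs _; rewrite !inE (simpleP gs).2. Qed.

Lemma card_edges g : regular d g -> #|edges g| = n * d.
Proof.
move=> gr; rewrite (_ : edges g = [set p | g (p.1, p.2)]); last first.
  by apply/setP=> -[a b]; rewrite !inE.
rewrite (card_pairs (fun a b => g (a, b))) (eq_bigr (fun=> d)).
  by rewrite sum_nat_const card_ord.
by move=> a _; rewrite -[RHS](card_nbrs a gr).
Qed.

(** Its share of [reg_graphs n d] is the probability that G contains F; conditioning on F means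
    counting inside [regs F]. *)
Definition regs F : {set graph n} := [set g in reg_graphs n d | F \subset edges g].

Lemma regs0 : regs set0 = reg_graphs n d.
Proof. by apply/setP=> g; rewrite inE sub0set andbT. Qed.

Definition revset F : {set 'I_n * 'I_n} := [set p | (p.2, p.1) \in F].

Lemma card_revset F : #|revset F| = #|F|.
Proof.
have i : injective (fun p : 'I_n * 'I_n => (p.2, p.1)) by move=> [a b] [a' b'] [-> ->].
rewrite -(card_imset F i); congr #|pred_of_set _|; apply/setP=> -[a b]; rewrite inE /=.
apply/idP/imsetP => [h|[[x y] h [-> ->]]] //; by exists (b, a).
Qed.

(* Switching: trade the edges uv and xy for ux and vy.  There are at least dn/2
   admissible (x, y), and a given result arises from at most d^2 of them. *)
Lemma regs_step F u v : (u, v) \notin F -> (v, u) \notin F ->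
  8 * #|F| <= d * n -> 8 * (d + 1) <= n -> 0 < d ->
  #|regs ((u, v) |: F)| * n <= #|regs F| * (2 * d).
Proof.
move=> uvF vuF hF hn d0.
(* At least dn/2 against at most d^2; cancelling d/2 leaves n against 2d. *)
suff : #|regs ((u, v) |: F)| * uphalf (d * n) <= #|regs F| * (d * d).
  have := leq_uphalf_double (d*n) (uphalf (d * n)); rewrite leqnn => /esym h.
  move=> h2. rewrite -(leq_pmul2r d0). nia.
pose P g := [set p : 'I_n * 'I_n | [&& g p, p \notin F, p \notin revset F, p.1 \notin u |: nbrs g
  u & p.2 \notin v |: nbrs g v]].
pose Q g := [set p : 'I_n * 'I_n | (p.1 \in nbrs g u) && (p.2 \in nbrs g v)].
have cQ g : regular d g -> #|Q g| = d * d.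
  by move=> gr; rewrite -{1}(card_nbrs u gr) -(card_nbrs v gr) -cardsX; apply: eq_card => p;
    rewrite !inE.
pose f g (p : 'I_n * 'I_n) := switch g ((v, p.2), (u, p.1)).
apply: (@double_count _ _ _ _ P Q f); first by move=> b g g'; apply: switch_inj.
- move=> g [x y]; rewrite !inE /= => /andP[gr /subsetP FE] /and5P[gxy xyF yxF];
  rewrite !negb_or => /andP[xu gux] /andP[yv gvy].
  have guv : g (u, v) by have := FE (u, v); rewrite !inE eqxx; apply.
  have gs := (simpleP (andP gr).1).2.
  have ha : switchable g v u x y.
    by rewrite /switchable eq_sym yv eq_sym xu gs guv gux gxy gs gvy.
  have E p : f g (x, y) p = g p (+) edge_pair v u p (+) edge_pair u x p (+) edge_pair x y p (+)
    edge_pair y v p by rewrite ffunE.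
  have reg' := switch_regular gr ha.
  have uv : u != v by apply: (@edges_irr g _ _ gr); rewrite inE.
  have xy : x != y by apply: (@edges_irr g _ _ gr); rewrite inE.
  split; last first.
    have xv : x != v by apply/eqP=> h; move: gux; rewrite /adj h guv.
    have yu : y != u by apply/eqP=> h; move: gvy; rewrite /adj h gs guv.
    rewrite /adj !E; move: gux gvy; rewrite /adj => /negbTE-> /negbTE->.
    have ne (a b : 'I_n) : a != b -> ((a == b) = false) * ((b == a) = false).
      by move=> h; split; [|rewrite eq_sym]; apply: negbTE.
    by rewrite /edge_pair !xpair_eqE !eqxx ?(ne _ _ uv) ?(ne _ _ xu) ?(ne _ _ xv) ?(ne _ _ yu)
      ?(ne _ _ yv) ?(ne _ _ xy).
  rewrite reg' /=; apply/subsetP=> q qF; rewrite inE E.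
  have gq : g q by have := FE q; rewrite !inE qF orbT; apply.
  rewrite gq.
  have -> : edge_pair v u q = false.
    by apply/negP=> /orP[] /eqP h; rewrite h in qF; rewrite qF in uvF vuF.
  have -> : edge_pair u x q = false.
    by apply/negP=> /orP[] /eqP h; rewrite h in gq; move: gux; rewrite /adj ?gq // gs gq.
  have -> : edge_pair x y q = false.
    by apply/negP=> /orP[] /eqP h; rewrite h in qF; rewrite qF in xyF yxF.
  have -> // : edge_pair y v q = false.
    by apply/negP=> /orP[] /eqP h; rewrite h in gq; move: gvy; rewrite /adj ?gq // gs gq.
- move=> g; rewrite inE => /andP[]; rewrite inE => gr _.
  (* F and its reverse exclude at most 2|F| <= dn/4 pairs, the closed neighbourhoods of u and v at
     most 2d(d + 1) <= dn/4, which leaves half. *)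
  pose b1 := [set p : 'I_n * 'I_n | (p.1 \in u |: nbrs g u) && (p.2 \in nbrs g p.1)].
  pose b2 := [set p : 'I_n * 'I_n | (p.2 \in v |: nbrs g v) && (p.1 \in nbrs g p.2)].
  have cN (t : 'I_n) : #|t |: nbrs g t| <= d + 1.
    by rewrite cardsU1 (card_nbrs t gr); case: (_ \notin _); rewrite ?addn0 //= addnC //; lia.
  have cb1 : #|b1| <= (d + 1) * d.
    rewrite (@card_fibers_const _ _ (u |: nbrs g u) (nbrs g) d) ?leq_mul //.
    by move=> a _; apply: card_nbrs.
  have cb2 : #|b2| <= (d + 1) * d.
    rewrite -card_revset.
    rewrite (_ : revset b2 = [set p | (p.1 \in v |: nbrs g v) && (p.2 \in nbrs g p.1)]); last first.
      by apply/setP=> -[a b]; rewrite !inE.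
    rewrite (@card_fibers_const _ _ (v |: nbrs g v) (nbrs g) d) ?leq_mul //.
    by move=> a _; apply: card_nbrs.
  have sub : edges g \subset P g :|: (F :|: revset F :|: b1 :|: b2).
    apply/subsetP=> -[a b]; rewrite !inE /= /adj => gab.
    have gba : g (b, a) by rewrite (simpleP (andP gr).1).2.
    by rewrite gab gba /= !andbT; do !case: (_ \in _) => //=; do !case: (_ == _) => //=;
      do 2!case: (g _).
  have := leq_card_cover4 sub (leqnn #|F|) (eq_leq (card_revset F)) cb1 cb2.
  rewrite (card_edges gr) leq_uphalf_double (mulnC n) => h.
  have hq : 2 * ((d + 1) * d) * 4 <= d * n by nia.
  move: hq hF h; move: #|P g| #|F| (d * n) ((d + 1) * d) => a b X Y; lia.
- by move=> g; rewrite inE => /andP[]; rewrite inE => gr _; rewrite cQ.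
Qed.
End Counts.

Section Counts2.
Variables (n d : nat).
Implicit Types (g : graph n) (F B : {set 'I_n * 'I_n}).

(** The condition p.1 < p.2 keeps the reverse of each edge out of F, as every [regs_step] requires;
    |F| steps give (2d/n)^|F|. *)
Lemma card_regs_leq F : (forall p, p \in F -> (p.1 < p.2)%N) ->
  8 * #|F| <= d * n -> 8 * (d + 1) <= n -> 0 < d ->
  #|regs d F| * n ^ #|F| <= #|reg_graphs n d| * (2 * d) ^ #|F|.
Proof.
move=> + + hn d0; elim: {F}_.+1 {-2}F (ltnSn #|F|) => // m IH F + hF h8.
case: (set_0Vmem F) => [->|[[u v] uvF]]; first by rewrite cards0 regs0 !expn0.
have hFc := cardsD1 (u, v) F; rewrite uvF add1n in hFc.
rewrite hFc !ltnS => hm.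
have hF' p : p \in F :\ (u, v) -> p.1 < p.2 by rewrite !inE => /andP[_ /hF].
have := IH _ hm hF'; rewrite hFc in h8; 
have h8' : 8 * #|F :\ (u, v)| <= d * n by apply: leq_trans h8; rewrite leq_mul2l leqnSn orbT.
move=> /(_ h8') IH'.
have uvN : (u, v) \notin F :\ (u, v) by rewrite !inE eqxx.
have vuN : (v, u) \notin F :\ (u, v).
  by apply/negP=> /hF' /=; have /= := hF _ uvF; lia.
have := @regs_step n d _ u v uvN vuN h8' hn d0.
rewrite setD1K // => st.
rewrite !expnSr !mulnA; apply: leq_trans (_ : #|regs d (F :\ (u, v))| * (2 * d) * n ^ #|F :\ (u,
  v)| <= _).
  by rewrite mulnAC leq_mul2r st orbT.
by rewrite mulnAC -!mulnA (mulnA _ 2 d) -!mulnA !(mulnA _ _ (2*d)) leq_mul2r IH' orbT.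
Qed.

Definition sparse_on F B j := [set g in regs d F | #|edges g :&: B| <= j].

(** Counts walks x, y, w, u in which y = w is allowed: the positions where a switching would create
    a loop or an edge yw that already exists. *)
Lemma card_walk4 g : regular d g ->
  #|[set t : ('I_n * 'I_n) * ('I_n * 'I_n) | [&& t.2.2 \in t.2.1 |: nbrs g t.2.1,
      t.1.1 \in nbrs g t.2.1 & t.1.2 \in nbrs g t.2.2]]| <= n * (d + 1) * (d * d).
Proof.
move=> gr.
pose sw (t : ('I_n * 'I_n) * ('I_n * 'I_n)) := (t.2, t.1).
have swi : injective sw by move=> [a b] [a' b'] [-> ->].
rewrite -(card_imset _ swi).
pose P := [set p : 'I_n * 'I_n | (p.1 \in setT) && (p.2 \in p.1 |: nbrs g p.1)].
have cP : #|P| = n * (d + 1).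
  rewrite (@card_fibers_const _ _ setT (fun a => a |: nbrs g a) (d + 1)).
    by rewrite cardsT card_ord.
  move=> a _; rewrite cardsU1 (card_nbrs a gr) !inE /adj.
  by rewrite (simpleP (andP gr).1).1 addnC.
rewrite -cP -(@card_fibers_const _ _ P (fun p => setX (nbrs g p.1) (nbrs g p.2))); last first.
  by move=> a _; rewrite cardsX !(card_nbrs _ gr).
apply: subset_leq_card; apply/subsetP=> q /imsetP[[[x u] [y w]]].
by rewrite !inE /= => h ->; rewrite /sw /=.
Qed.

(* Switching: trade the edges xy and uw for xu and yw, where xu is in B.  Removing
   edges cannot enlarge the intersection with B, hence no care is needed about the
   position of xy and uw relative to B; the four new ordered pairs give j + 4. *)
Lemma sparse_on_step F B C j : 
  (forall x, (x, x) \notin B) -> n ^ 2 <= C * #|B| -> 16 * C * #|F| <= n * d ->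
  8 * C * d <= n -> 16 * C * (j + 4) <= n * d -> 0 < d -> 0 < n ->
  4 * #|sparse_on F B j| <= #|sparse_on F B (j + 4)|.
Proof.
move=> Birr hB hF hn hj d0 n0.
have nd0 : 0 < n * d by rewrite muln_gt0 n0 d0.
have l0 : 0 < (j + 4) * (n * d) by rewrite muln_gt0 nd0 addnS.
(* A graph has roughly |B| d^2 >= (nd)^2 / C switchings; a result fixes at most (j + 4) nd of them,
   by xu among its pairs in B and yw among its edges. *)
suff : #|sparse_on F B j| * (4 * ((j + 4) * (n * d))) <= #|sparse_on F B (j + 4)| * ((j + 4) * (n
  * d)).
  by rewrite mulnA leq_mul2r eqn0Ngt l0 mulnC.
pose T := (('I_n * 'I_n) * ('I_n * 'I_n))%type.
pose FF := F :|: revset F.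
pose P g := [set t : T | [&& t.1 \in B :\: edges g, (t.1.1, t.2.1) \in edges g :\: FF, (t.1.2,
  t.2.2) \in edges g :\: FF, t.2.1 != t.2.2 & t.2 \notin edges g]].
pose Q g := setX (edges g :&: B) (edges g).
apply: (@double_count _ _ _ _ P Q (@switch n)); first by move=> b g g'; apply: switch_inj.
- move=> g [[x u] [y w]]; rewrite !inE /= => /andP[/andP[gr /subsetP FE] gB].
  case/and5P=> /andP[gxu xuB] /andP[] /norP[xyF yxF] gxy /andP[] /norP[uwF wuF] guw yw gyw.
  have gs := (simpleP (andP gr).1).2.
  have xu : x != u by apply: contraTneq xuB => ->.
  have ha : switchable g x y w u by rewrite /switchable xu yw gxy gyw (gs w) guw (gs u) gxu.
  have E p : switch g (x, u, (y, w)) p = g p (+) edge_pair x y p (+) edge_pair y w p (+)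
    edge_pair w u p (+) edge_pair u x p by rewrite ffunE.
  have reg' := switch_regular gr ha.
  have xy : x != y by apply: (@edges_irr _ _ g _ _ gr); rewrite inE.
  have uw : u != w by apply: (@edges_irr _ _ g _ _ gr); rewrite inE.
  have xw : x != w by apply/eqP=> h; move: gyw; rewrite -h gs gxy.
  have yu : y != u by apply/eqP=> h; move: gyw; rewrite h guw.
  have ne (a b : 'I_n) : a != b -> ((a == b) = false) * ((b == a) = false).
    by move=> h; split; [|rewrite eq_sym]; apply: negbTE.
  have nn := (ne _ _ xy, ne _ _ uw, ne _ _ xw, ne _ _ yu, ne _ _ xu, ne _ _ yw).
  have Exu : switch g (x, u, (y, w)) (x, u).
    by rewrite E (negbTE gxu) /edge_pair !xpair_eqE !eqxx !nn.
  have Eyw : switch g (x, u, (y, w)) (y, w).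
    by rewrite E (negbTE gyw) /edge_pair !xpair_eqE !eqxx !nn.
  rewrite reg' Exu Eyw xuB /=; split=> //; apply/andP; split.
    apply/subsetP=> q qF; rewrite inE E.
    have gq : g q by have := FE q qF; rewrite inE.
    rewrite gq.
    have -> : edge_pair x y q = false.
      by apply/negP=> /orP[] /eqP h; rewrite h in qF; rewrite qF in xyF yxF.
    have -> : edge_pair y w q = false.
      by apply/negP=> /orP[] /eqP h; rewrite h in gq; move: gyw; rewrite ?gq // gs gq.
    have -> : edge_pair w u q = false.
      by apply/negP=> /orP[] /eqP h; rewrite h in qF; rewrite qF in uwF wuF.
    have -> // : edge_pair u x q = false.
      by apply/negP=> /orP[] /eqP h; rewrite h in gq; move: gxu; rewrite ?gq // gs gq.
  apply: leq_trans (_ : #|(edges g :&: B) :|: ([set (x, u); (u, x)] :|: [set (y, w);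
    (w, y)])| <= _).
    apply: subset_leq_card; apply/subsetP=> q; rewrite !inE E => /andP[+ ->]; rewrite andbT;
      case gq: (g q) => //.
    have -> : edge_pair x y q = false.
      by apply/negP=> /orP[] /eqP h; move: gq; rewrite h ?gxy // gs gxy.
    have -> : edge_pair w u q = false.
      by apply/negP=> /orP[] /eqP h; move: gq; rewrite h ?guw // gs guw.
    rewrite /edge_pair; case: (q == (x, u)); case: (q == (u, x)); case: (q == (y, w)) => //=.
    by case: (q == (w, y)).
  have hU (X Y : {set 'I_n * 'I_n}) : #|X :|: Y| <= #|X| + #|Y| by rewrite cardsU leq_subr.
  apply: leq_trans (hU _ _) _; apply: leq_add => //.
  by apply: leq_trans (hU _ _) _; rewrite !cards2; do 2!case: (_ != _).
- move=> g; rewrite !inE => /andP[/andP[gr FE] gB].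
  have gs := (simpleP (andP gr).1).2.
  pose A := [set t : T | (t.1 \in B :\: edges g) && (t.2 \in setX (nbrs g t.1.1) (nbrs g t.1.2))].
  have cA : #|A| = #|B :\: edges g| * (d * d).
    rewrite (@card_fibers_const _ _ _ (fun p => setX (nbrs g p.1) (nbrs g p.2)) (d * d)) //.
    by move=> a _; rewrite cardsX !(card_nbrs _ gr).
  pose sh (t : T) : T := ((t.1.1, t.2.1), (t.1.2, t.2.2)).
  have shi : injective sh by move=> [[a b] [a' b']] [[c e] [c' e']] [-> -> -> ->].
  pose B1 := [set t : T | ((t.1.1, t.2.1) \in FF) && ((t.1.2, t.2.2) \in edges g)].
  pose B2 := [set t : T | ((t.1.1, t.2.1) \in edges g) && ((t.1.2, t.2.2) \in FF)].
  pose B3 := [set t : T | [&& t.2.2 \in t.2.1 |: nbrs g t.2.1,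
      t.1.1 \in nbrs g t.2.1 & t.1.2 \in nbrs g t.2.2]].
  have cFF : #|FF| <= 2 * #|F| by rewrite cardsU card_revset mul2n -addnn leq_subr.
  have cB1 : #|B1| <= 2 * #|F| * (n * d).
    apply: leq_trans (_ : #|FF| * (n * d) <= _); last by rewrite leq_mul2r cFF orbT.
    rewrite -(card_edges gr) -cardsX -(card_imset _ shi); apply: subset_leq_card.
    by apply/subsetP=> q /imsetP[[[x u] [y w]] + ->]; rewrite !inE.
  have cB2 : #|B2| <= 2 * #|F| * (n * d).
    apply: leq_trans (_ : #|FF| * (n * d) <= _); last by rewrite leq_mul2r cFF orbT.
    rewrite mulnC -(card_edges gr) -cardsX -(card_imset _ shi); apply: subset_leq_card.
    by apply/subsetP=> q /imsetP[[[x u] [y w]] + ->]; rewrite !inE.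
  have cB3 := card_walk4 gr.
  have sub : A \subset P g :|: (B1 :|: B2 :|: B3 :|: set0).
    apply/subsetP=> -[[x u] [y w]]; rewrite !inE /= /adj => /andP[/andP[-> ->] /andP[gxy guw]].
    rewrite gxy guw (gs y x) gxy (gs w u) guw /= !orbF !andbT.
    rewrite [w == y]eq_sym.
    by do 4!case: (_ \in F) => //=; case: (y == w) => //=; case: (g _).
  have := leq_card_cover4 sub cB1 cB2 cB3 (eq_leq (cards0 _)).
  rewrite cA addn0 => h.
  have hBE : #|B| <= #|B :\: edges g| + j.
    by rewrite -(cardsID (edges g) B) addnC leq_add2l setIC.
  move: hB hF h hBE; move: #|P g| #|B :\: edges g| #|F| #|B| => p b f bb hB hF h hBE.
  have C0 : 0 < C by case: (posnP C) hB => // ->; rewrite mul0n leqn0 expn_eq0; lia.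
  rewrite -(leq_pmul2l C0).
  (* After multiplication by C, as fractions of (nd)^2: pairs of B already present cost at most
     1/16, F at most 1/4, short walks at most 1/4, and the target 4 (j + 4) nd is at most 1/4. *)
  have hdn : d <= n by nia.
  have X2 : n * n * (d * d) = n * d * (n * d) by nia.
  have ha : 16 * (C * j * (d * d)) <= n * d * (n * d).
    have e1 : 16 * (C * j) <= n * d by nia.
    have e2 : d * d <= n * d by rewrite leq_mul2r hdn orbT.
    by have := leq_mul e1 e2; rewrite !mulnA.
  have hb : 16 * (C * f * (n * d)) <= n * d * (n * d).
    by have := leq_mul hF (leqnn (n * d)); rewrite !mulnA.
  have hc : 4 * (C * (n * (d + 1) * (d * d))) <= n * d * (n * d).
    have e1 : 4 * (C * (d + 1)) <= n by nia.
    have := leq_mul e1 (leqnn (n * (d * d))); rewrite -X2; nia.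
  have he : 16 * (C * ((j + 4) * (n * d))) <= n * d * (n * d).
    by have := leq_mul hj (leqnn (n * d)); rewrite !mulnA.
  have hf : n * n * (d * d) <= C * b * (d * d) + C * j * (d * d).
    by rewrite -mulnDl -mulnDr leq_mul2r; apply/orP; right; nia.
  have hg : C * b * (d * d) <= C * p + (4 * (C * f * (n * d)) + C * (n * (d + 1) * (d * d))).
    have := leq_mul (leqnn C) h; lia.
  rewrite X2 in hf.
  have -> : C * (4 * ((j + 4) * (n * d))) = 4 * (C * ((j + 4) * (n * d))) by rewrite mulnCA.
  move: ha hb hc he hf hg.
  move: (C * j * (d * d)) (C * f * (n * d)) (C * (n * (d + 1) * (d * d))) (C * ((j + 4) * (n *
    d))) (C * b * (d * d)) (n * d * (n * d)) (C * p).
  lia.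
- move=> g; rewrite !inE => /andP[/andP[gr FE] gB].
  by rewrite /Q cardsX (card_edges gr) leq_mul2r gB orbT.
Qed.
End Counts2.

(** * Typical properties of regular graphs *)

Lemma bin_le_exp2 n k : 'C(n, k) <= 2 ^ n.
Proof.
rewrite -[n in 2 ^ n]card_ord -cardsT -card_powerset -[n in 'C(n, _)](card_ord n) -cardsT
  -(cards_draws [set: 'I_n] k).
by apply: subset_leq_card; apply/subsetP=> A; rewrite !inE => /andP[].
Qed.

(** The bound (4n/k)^k, with 4 in place of e because k^k / k! is at most the central binomial
    coefficient, hence at most 4^k. *)
Lemma bin_leq_exp n k : 'C(n, k) * k ^ k <= (4 * n) ^ k.
Proof.
have h1 : k ^ k <= (2 * k) ^_ k.
  rewrite ffact_prod -[X in X <= _](_ : \prod_(i < k) k = _); last first.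
    by rewrite prod_nat_const card_ord.
  by apply: leq_prod => i _; have := ltn_ord i; lia.
have h2 : k ^ k <= 4 ^ k * k`!.
  apply: leq_trans h1 _; rewrite -bin_ffact leq_mul2r.
  by rewrite (_ : 4 ^ k = 2 ^ (2 * k)) ?bin_le_exp2 ?orbT // expnM.
apply: leq_trans (leq_mul (leqnn _) h2) _.
rewrite mulnCA bin_ffact expnMn leq_mul2l; apply/orP; right.
rewrite ffact_prod -[X in _ <= X](_ : \prod_(i < k) n = _); last first.
  by rewrite prod_nat_const card_ord.
by apply: leq_prod => i _; lia.
Qed.

Lemma leq_card_bigcup (I T : finType) (P : pred I) (S : I -> {set T}) :
  #|\bigcup_(i | P i) S i| <= \sum_(i | P i) #|S i|.
Proof.
elim/big_rec2: _ => [|i m A _ h]; first by rewrite cards0.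
by apply: leq_trans (leq_add (leqnn _) h); rewrite cardsU leq_subr.
Qed.

Lemma union_bound (I T : finType) (P : pred I) (S : I -> {set T}) (Z : {set T}) a b :
  (forall g, g \in Z -> exists2 i, P i & g \in S i) ->
  (forall i, P i -> #|S i| * a <= b) ->
  #|Z| * a <= #|[set i | P i]| * b.
Proof.
move=> hZ hS; apply: leq_trans (_ : (\sum_(i | P i) #|S i|) * a <= _).
  rewrite leq_mul2r; apply/orP; right; apply: leq_trans (leq_card_bigcup P S).
  apply: subset_leq_card; apply/subsetP=> g /hZ [i Pi gi].
  by apply/bigcupP; exists i.
rewrite big_distrl /=.
have -> : #|[set i | P i]| * b = \sum_(i | P i) b.
  by rewrite sum_nat_const; congr (_ * _); apply: eq_card => i; rewrite inE.
exact: leq_sum.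
Qed.

Lemma subset_extend (T : finType) (A U : {set T}) k :
  A \subset U -> #|A| <= k <= #|U| -> exists B : {set T}, [/\ A \subset B, B \subset U & #|B| = k].
Proof.
move=> AU; elim: k => [|k IH] /andP[h1 h2].
  by exists A; split=> //; apply/eqP; rewrite -leqn0.
case: (ltngtP #|A| k.+1) h1 => // h1 _; last by exists A; split.
case: IH; first by rewrite -ltnS h1 ltnW.
move=> B [AB BU cB].
have : ~~ (U \subset B) by apply/negP=> /subset_leq_card; lia.
case/subsetPn=> x xU xB; exists (x |: B); split.
- exact: subset_trans AB (subsetUr _ _).
- by rewrite subUset sub1set xU.
- by rewrite cardsU1 xB cB.
Qed.

(** The induction proves that the sum is at most c (1 - 2^(-m)), written without subtraction. *)
Lemma geom_sum (b : nat -> nat) c m : (forall s, 0 < s -> b s * 2 ^ s <= c) ->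
  \sum_(1 <= s < m.+1) b s <= c.
Proof.
move=> hb; have h : (\sum_(1 <= s < m.+1) b s) * 2 ^ m + c <= c * 2 ^ m.
  elim: m => [|m IH]; first by rewrite big_geq // mul0n add0n muln1.
  rewrite big_nat_recr //= mulnDl expnS.
  have := hb m.+1 isT; rewrite expnS; nia.
have : 0 < 2 ^ m by rewrite expn_gt0.
by move: (2 ^ m) h => p; nia.
Qed.

Section Events.
Variables (n d : nat).
Implicit Types (g : graph n) (F B : {set 'I_n * 'I_n}).

(** Each of i rounds of switchings raises the allowance by 4 and multiplies the number of graphs by
    at least 4. *)
Lemma sparse_on_bound F B C j i :
  (forall x, (x, x) \notin B) -> n ^ 2 <= C * #|B| -> 16 * C * #|F| <= n * d ->
  8 * C * d <= n -> 16 * C * (j + 4 * i) <= n * d -> 0 < d -> 0 < n ->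
  #|sparse_on d F B j| * 4 ^ i <= #|regs d F|.
Proof.
move=> h1 h2 h3 h4 h5 d0 n0; elim: i j h5 => [|i IH] j h5.
  by rewrite muln1 subset_leq_card //; apply/subsetP=> g; rewrite inE => /andP[].
rewrite expnS mulnA; apply: leq_trans (IH (j + 4) _); last by apply: leq_trans h5;
  rewrite leq_mul2l; lia.
rewrite leq_mul2r mulnC (@sparse_on_step n d F B C j) ?orbT //.
by apply: leq_trans h5; rewrite leq_mul2l; lia.
Qed.

Definition upedges g := [set p in edges g | p.1 < p.2].

Lemma card_upedges g : regular d g -> 2 * #|upedges g| = n * d.
Proof.
move=> gr; have gs := (simpleP (andP gr).1).2.
rewrite -(card_edges gr) mul2n -addnn -[in X in X + _](card_revset (upedges g)).
rewrite -cardsUI [X in _ + X](_ : _ = 0) ?addn0.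
  apply: eq_card => -[x y]; rewrite !inE /= gs -andb_orr.
  case gxy : (g _) => //=.
  have exy : (x, y) \in edges g by rewrite inE.
  by have := edges_irr gr exy; rewrite neq_ltn orbC.
apply/eqP; rewrite cards_eq0; apply/eqP/setP=> -[x y]; rewrite !inE /=.
by apply/negP; lia.
Qed.

(** This yields expansion of small sets: when 6r neighbours per vertex are kept, a small set with
    few outer neighbours would span too many edges together with them. *)
Definition sparse_small r K g :=
  [forall W : {set 'I_n}, (W != set0) && (32 * K * #|W| <= n) ==>
     (#|upedges g :&: setX W W| < r * #|W|)].

(** With Y = 16Ks the binomials and (2d)^(rs) amount to (4n/s)^s Y^(rs), that is, together with 2^s
    and n^(-rs), to a factor (128K n/Y) (Y/n)^r per vertex. Since 2Y <= n, r - 2 of the factors Y/n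
    absorb 128K, one cancels n/Y and one remains. *)
Lemma small_term_bound r K s M : 0 < r -> 0 < K -> 0 < s -> d <= 2 * K * r -> 128 * K <= 2 ^ (r -
  2) ->
  2 <= r -> 32 * K * s <= n -> 0 < n ->
  ('C(n, s) * 'C(s * s, r * s)) * (M * (2 * d) ^ (r * s)) * (n * 2 ^ s) <= 32 * K * M * n ^ (r * s).
Proof.
move=> r0 K0 s0 dK hK r2 hs n0; set Y := 16 * K * s.
have Yn : 2 * Y <= n by apply: leq_trans hs; rewrite /Y; lia.
have Y0 : 0 < Y by rewrite !muln_gt0 K0 s0.
have rs0 : 0 < r * s by rewrite muln_gt0 r0.
have e1 : 'C(n, s) * 'C(s * s, r * s) * (2 * d) ^ (r * s) * s ^ s <= (4 * n) ^ s * Y ^ (r * s).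
  have p : 0 < (r * s) ^ (r * s) by rewrite expn_gt0 rs0.
  rewrite -(leq_pmul2r p).
  have b1 := bin_leq_exp n s; have b2 := bin_leq_exp (s * s) (r * s).
  have b3 : (2 * d) ^ (r * s) <= (4 * K * r) ^ (r * s) by rewrite leq_exp2r //; lia.
  have := leq_mul (leq_mul b1 b2) b3.
  have -> : (4 * n) ^ s * (4 * (s * s)) ^ (r * s) * (4 * K * r) ^ (r * s) =
     (4 * n) ^ s * Y ^ (r * s) * (r * s) ^ (r * s).
    by rewrite -!mulnA -!expnMn; congr (_ * _ ^ _); rewrite /Y; lia.
  by apply: leq_trans; rewrite leq_eqVlt; apply/orP; left; apply/eqP; lia.
have sp : 0 < s ^ s * (16 * K) ^ s by rewrite muln_gt0 !expn_gt0 s0 muln_gt0 K0.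
have e2 : (4 * n) ^ s * Y ^ (r * s) * (n * 2 ^ s) * (16 * K) ^ s <= 32 * K * n ^ (r * s) * Y ^ s.
  have -> : (4 * n) ^ s * Y ^ (r * s) * (n * 2 ^ s) * (16 * K) ^ s = (128 * K * n * Y ^ r) ^ s * n.
    rewrite [_ * (n * _)]mulnCA -!mulnA [RHS]mulnC; congr (_ * _).
    by rewrite expnM -!expnMn; congr (_ ^ _); lia.
  have e3 : 128 * K * n * Y ^ r <= n ^ (r - 1) * Y ^ 2.
    have -> : Y ^ r = Y ^ (r - 2) * Y ^ 2 by rewrite -expnD subnK.
    have -> : n ^ (r - 1) = n ^ (r - 2) * n by rewrite -expnSr; congr (_ ^ _); lia.
    rewrite mulnA leq_mul2r; apply/orP; right.
    rewrite mulnAC leq_mul2r; apply/orP; right.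
    apply: leq_trans (_ : (2 * Y) ^ (r - 2) <= _); last by case: (r - 2) => // m; rewrite leq_exp2r.
    by rewrite expnMn leq_mul2r hK orbT.
  (* The remaining (Y/n)^s supplies the 1/n of the bound: one Y is at most 32K 2^(s-1), and the
     other s - 1 factors Y are at most n/2. *)
  have e4 : Y ^ s * n <= 32 * K * n ^ s.
    have [t st] : exists t, s = t.+1 by exists s.-1; rewrite prednK.
    have hs2 : s <= 2 * 2 ^ t by rewrite -expnS -st; apply/ltnW/ltn_expl.
    have hY : Y <= 32 * K * 2 ^ t by rewrite /Y; nia.
    have ht : (2 * Y) ^ t <= n ^ t by case: (t) => // m; rewrite leq_exp2r.
    rewrite st expnS (expnS n) (mulnC n) mulnA leq_mul2r; apply/orP; right.
    apply: leq_trans (leq_mul hY (leqnn _)) _.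
    by rewrite -mulnA -expnMn leq_mul2l ht orbT.
  apply: leq_trans (_ : (n ^ (r - 1) * Y ^ 2) ^ s * n <= _).
    by rewrite leq_mul2r leq_exp2r // e3 orbT.
  have -> : (n ^ (r - 1) * Y ^ 2) ^ s * n = n ^ ((r - 1) * s) * Y ^ s * (Y ^ s * n).
    by rewrite expnMn -!expnM mul2n -addnn expnD !mulnA.
  apply: leq_trans (leq_mul (leqnn _) e4) _.
  have -> : n ^ (r * s) = n ^ ((r - 1) * s) * n ^ s by rewrite -expnD; congr (_ ^ _); nia.
  by apply: eq_leq; lia.
rewrite -(leq_pmul2r sp).
have eY : Y ^ s = (16 * K) ^ s * s ^ s by rewrite -expnMn.
rewrite eY in e2.
have := leq_mul (leq_mul e1 (leqnn (M * (n * 2 ^ s)))) (leqnn ((16 * K) ^ s)).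
have := leq_mul e2 (leqnn M).
move: ('C(n, s)) ('C(s * s, r * s)) ((2 * d) ^ (r * s)) (s ^ s) ((4 * n) ^ s) (Y ^ (r * s)) (2 ^
  s) ((16 * K) ^ s) (n ^ (r * s)).
move=> c1 c2 c3 c4 c5 c6 c7 c8 c9 h1 h2.
have -> : c1 * c2 * (M * c3) * (n * c7) * (c4 * c8) = c1 * c2 * c3 * c4 * (M * (n * c7)) * c8 by
  lia.
apply: leq_trans h2 _.
have -> : c5 * c6 * (M * (n * c7)) * c8 = c5 * c6 * (n * c7) * c8 * M by lia.
by apply: leq_trans h1 _; apply: eq_leq; lia.
Qed.

(** A violating W is counted together with r|W| of the edges it spans. Sizes are treated separately,
    since the bound for size s carries a factor 2^(-s) and can be summed by [geom_sum]. *)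
Lemma event_sparse r K : 2 <= r -> 0 < K -> r <= d -> d <= 2 * K * r -> 128 * K <= 2 ^ (r - 2) ->
  8 * (d + 1) <= n ->
  #|[set g in reg_graphs n d | ~~ sparse_small r K g]| * n <= #|reg_graphs n d| * (32 * K).
Proof.
move=> r2 K0 rd dK hK hn.
have d0 : 0 < d by lia.
have n0 : 0 < n by lia.
set M := #|reg_graphs n d|.
pose I := ({set 'I_n} * {set 'I_n * 'I_n})%type.
pose P s (i : I) := [&& #|i.1| == s, i.2 \subset setX i.1 i.1, #|i.2| == r * s & [forall p in
  i.2, p.1 < p.2]].
pose Bad s := \bigcup_(i | P s i) regs d i.2.
have hBad s : 0 < s -> 32 * K * s <= n -> #|Bad s| * (n * 2 ^ s) <= 32 * K * M.
  move=> s0 hs.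
  have h8 : 8 * (r * s) <= d * n by nia.
  have e1 : #|Bad s| * n ^ (r * s) <= #|[set i | P s i]| * (M * (2 * d) ^ (r * s)).
    apply: (union_bound (S := fun i => regs d i.2)).
      by move=> g /bigcupP[i Pi gi]; exists i.
    move=> [W F] /and4P[/eqP /= cW FW /eqP cF /forallP Flt].
    rewrite -cF; apply: card_regs_leq; rewrite ?cF //.
    by move=> p pF; move: (Flt p); rewrite pF.
  have e2 : #|[set i | P s i]| <= 'C(n, s) * 'C(s * s, r * s).
    apply: leq_trans (_ : #|[set p : I | (p.1 \in [set W : {set 'I_n} | #|W| == s]) && (p.2 \in
      [set F : {set 'I_n * 'I_n} | (F \subset setX p.1 p.1) && (#|F| == r * s)])]| <= _).
      by apply: subset_leq_card; apply/subsetP=> -[W F]; rewrite !inE /= => /and4P[-> -> -> _].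
    rewrite (@card_fibers_const _ _ [set W : {set 'I_n} | #|W| == s] (fun W => [set F : {set 'I_n
      * 'I_n} | (F \subset setX W W) && (#|F| == r * s)]) ('C(s * s, r * s))).
      by rewrite card_draws card_ord.
    by move=> W; rewrite inE => /eqP cW; rewrite cards_draws cardsX cW.
  have e3 := @small_term_bound r K s M ltac:(lia) K0 s0 dK hK r2 hs n0.
  have np : 0 < n ^ (r * s) by rewrite expn_gt0 n0.
  rewrite -(leq_pmul2r np); apply: leq_trans e3.
  rewrite mulnAC leq_mul2r; apply/orP; right; apply: leq_trans e1 _.
  by rewrite leq_mul2r e2 orbT.
pose b s := if 32 * K * s <= n then #|Bad s| * n else 0.
have hb s : 0 < s -> b s * 2 ^ s <= 32 * K * M.
  by move=> s0; rewrite /b; case: ifP => // hs; rewrite -mulnA hBad.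
have := geom_sum n hb; rewrite [M * _]mulnC; apply: leq_trans.
apply: leq_trans (_ : \sum_(1 <= s < n.+1 | 32 * K * s <= n) #|Bad s| * n <= _); last first.
  by rewrite big_mkcond /=; apply: leq_sum => s _; rewrite /b; case: ifP.
rewrite -big_distrl /= leq_mul2r; apply/orP; right.
rewrite big_mkcond /= big_add1 /= big_mkord -big_mkcond /=.
apply: leq_trans (leq_card_bigcup _ _).
apply: subset_leq_card; apply/subsetP=> g; rewrite inE => /andP[gO].
rewrite negb_forall => /existsP[W]; rewrite negb_imply -leqNgt => /andP[/andP[W0 hW] hE].
have cW : 0 < #|W| by rewrite card_gt0.
have lW : #|W|.-1 < n by nia.
apply/bigcupP; exists (Ordinal lW) => /=; rewrite prednK //.
case: (@subset_extend _ set0 (upedges g :&: setX W W) (r * #|W|)); rewrite ?sub0set ?cards0 //.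
move=> F [_ FE cF]; apply/bigcupP; exists (W, F); last first.
  rewrite inE gO /=; apply: subset_trans FE _; apply/subsetP=> p; rewrite !inE.
  by case/andP=> /andP[].
apply/and4P; split=> //=; last 2 first.
- by rewrite cF.
- by apply/forallP=> p; apply/implyP=> /(subsetP FE); rewrite !inE => /andP[/andP[]].
- by apply: subset_trans FE (subsetIr _ _).
Qed.

Definition joined h j g :=
  [forall A : {set 'I_n}, forall A' : {set 'I_n},
    [&& [disjoint A & A'], n <= h * #|A| & n <= h * #|A'|] ==> (j < #|edges g :&: setX A A'|)].

(** Two sets of size n/h span at least n^2 / h^2 pairs. Going from 4i to 8i edges in i rounds needs
    128 h^2 i <= nd and gains 4^(-i) <= 16^(-n), against 4^n pairs of sets. *)
Lemma event_joined h i : 0 < n -> 0 < d -> 8 * h ^ 2 * d <= n -> 128 * h ^ 2 * i <= n * d -> 2 *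
  n <= i ->
  #|[set g in reg_graphs n d | ~~ joined h (4 * i) g]| * 4 ^ n <= #|reg_graphs n d|.
Proof.
move=> n0 d0 hn hi ni.
pose P (p : {set 'I_n} * {set 'I_n}) := [&& [disjoint p.1 & p.2], n <= h * #|p.1| & n <= h *
  #|p.2|].
pose S (p : {set 'I_n} * {set 'I_n}) := sparse_on d set0 (setX p.1 p.2) (4 * i).
have p4 : 0 < 4 ^ n by rewrite expn_gt0.
rewrite -(leq_pmul2r p4) -mulnA -expnD addnn -mul2n.
apply: leq_trans (_ : #|[set g in reg_graphs n d | ~~ joined h (4 * i) g]| * 4 ^ i <= _).
  by rewrite leq_mul2l leq_exp2l // ni orbT.
apply: leq_trans (@union_bound _ _ P S _ _ #|reg_graphs n d| _ _) _.
- move=> g; rewrite inE => /andP[gO]; rewrite negb_forall => /existsP[A].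
  rewrite negb_forall => /existsP[A']; rewrite negb_imply -leqNgt => /andP[PA hE].
  by exists (A, A') => //; rewrite inE regs0 gO.
- move=> [A A'] /and3P[/= dis hA hA']; rewrite -(regs0 n d).
  apply: (@sparse_on_bound _ _ (h ^ 2)) => //.
  + by move=> x; rewrite inE /=; apply/negP=> /andP[xA xA']; move/disjointFr: dis => /(_ _ xA);
    rewrite xA'.
  + by rewrite cardsX -[n ^ 2]mulnn -[h ^ 2]mulnn mulnACA leq_mul.
  + by rewrite cards0 muln0.
  + by apply: leq_trans hi; nia.
- rewrite mulnC leq_mul2l; apply/orP; right.
  apply: leq_trans (max_card _) _; rewrite card_prod.
  by rewrite -cardsT -powersetT card_powerset cardsT card_ord -expnD addnn -mul2n expnM.
Qed.

(** [Bf] is abstract because the probability estimate uses only its size and the absence of loops.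
    The threshold n^2 / 64 is what rotations provide: n/8 first ends times n/8 second ends. *)
Definition meets_boosters f (Bf : {set 'I_n * 'I_n} -> {set 'I_n} -> {set 'I_n * 'I_n}) g :=
  [forall F : {set 'I_n * 'I_n}, forall T : {set 'I_n},
    [&& F \subset upedges g, #|F| <= f & n ^ 2 <= 64 * #|Bf F T|] ==> (edges g :&: Bf F T != set0)].

(* In the union bound F is padded to exactly 7rn edges of g, so that one binomial
   coefficient (times 2^(7rn) for the choice of F inside) counts the possibilities. *)
Lemma event_boosters (Bf : {set 'I_n * 'I_n} -> {set 'I_n} -> {set 'I_n * 'I_n}) r K k : (forall
  F T x, (x, x) \notin Bf F T) ->
  0 < n -> 0 < d -> 0 < r -> 8 * (d + 1) <= n -> 512 * d <= n -> r * K <= d -> d <= 2 * K * r ->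
  1024 * 7 <= K -> 4096 * k <= K -> (8 * K) ^ 7 * 4 <= 4 ^ k ->
  #|[set g in reg_graphs n d | ~~ meets_boosters (7 * (r * n)) Bf g]| * 2 ^ n <= #|reg_graphs n d|.
Proof.
move=> Birr n0 d0 r0 hn8 hn512 rK dK hK hk hpow.
set M := #|reg_graphs n d|; set f := 7 * (r * n); set i := k * (r * n).
have rn0 : 0 < r * n by rewrite muln_gt0 r0.
have f0 : 0 < f by rewrite muln_gt0.
pose I := ({set 'I_n * 'I_n} * ({set 'I_n * 'I_n} * {set 'I_n}))%type.
pose P (p : I) := [&& #|p.1| == f, [forall q in p.1, q.1 < q.2], p.2.1 \subset p.1 & n ^ 2 <= 64
  * #|Bf p.2.1 p.2.2|].
pose S (p : I) := sparse_on d p.1 (Bf p.2.1 p.2.2) 0.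
have rKn : r * n * K <= n * d by rewrite [n * d]mulnC mulnAC leq_mul2r rK orbT.
have rn7 : 1024 * 7 * (r * n) <= n * d by apply: leq_trans rKn; rewrite mulnC leq_mul2l hK orbT.
have fnd : 1024 * f <= n * d by rewrite /f mulnA.
have e1 : #|[set g in reg_graphs n d | ~~ meets_boosters f Bf g]| * (4 ^ i * n ^ f) <= #|[set p |
  P p]| * (M * (2 * d) ^ f).
  apply: (union_bound (S := S)).
    move=> g; rewrite inE => /andP[gO]; rewrite negb_forall => /existsP[F].
    rewrite negb_forall => /existsP[T]; rewrite negb_imply negbK => /andP[/and3P[FE cF hB] /eqP hE].
    have gr : regular d g by move: gO; rewrite inE.
    have hu : #|F| <= f <= #|upedges g| by rewrite cF -(leq_pmul2l (isT : 0 < 2)) card_upedges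
      //; lia.
    have [F0 [FF0 F0E cF0]] := subset_extend FE hu.
    exists (F0, (F, T)).
      rewrite /P /= cF0 eqxx FF0 hB !andbT; apply/forallP=> p; apply/implyP=> /(subsetP F0E).
      by rewrite inE => /andP[].
    rewrite inE /= hE cards0 andbT inE gO /=; apply: subset_trans F0E _.
    by apply/subsetP=> p; rewrite inE => /andP[].
  move=> [F0 [F T]] /and4P[/= /eqP cF0 /forallP Flt FF0 hB].
  rewrite mulnA; apply: leq_trans (_ : #|regs d F0| * n ^ f <= _).
    rewrite leq_mul2r; apply/orP; right; apply: (@sparse_on_bound _ _ 64) => //.
    + by rewrite cF0.
    + rewrite add0n /i; apply: leq_trans rKn; rewrite [X in _ <= X]mulnC.
      by have := leq_mul hk (leqnn (r * n)); lia.
  rewrite -cF0; apply: card_regs_leq => //; last by rewrite cF0; lia.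
  by move=> p pF; move: (Flt p); rewrite pF.
have e2 : #|[set p | P p]| <= 'C(n * n, f) * (2 ^ f * 2 ^ n).
  apply: leq_trans (_ : #|[set p : I | (p.1 \in [set F : {set 'I_n * 'I_n} | #|F| == f]) && (p.2
    \in setX (powerset p.1) [set: {set 'I_n}])]| <= _).
    by apply: subset_leq_card; apply/subsetP=> -[F0 [F T]]; rewrite !inE /= => /and4P[-> _ -> _].
  rewrite (@card_fibers_const _ _ [set F : {set 'I_n * 'I_n} | #|F| == f] (fun F => setX
    (powerset F) [set: {set 'I_n}]) (2 ^ f * 2 ^ n)).
    by rewrite card_draws card_prod card_ord.
  move=> F; rewrite inE => /eqP cF; rewrite cardsX card_powerset cF; congr (_ * _).
  by rewrite -powersetT card_powerset cardsT card_ord.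
(* Per edge: 4n^2 / f for the binomial, 2 for membership in the inner set, 2d/n for presence; with f
   = 7rn and d <= 2Kr the product is below 8K. *)
have e3 : 'C(n * n, f) * 2 ^ f * (2 * d) ^ f <= (8 * K) ^ f * n ^ f.
  have p : 0 < f ^ f by rewrite expn_gt0 f0.
  rewrite -(leq_pmul2r p).
  have := leq_mul (bin_leq_exp (n * n) f) (leqnn (2 ^ f * (2 * d) ^ f)).
  have -> : (4 * (n * n)) ^ f * (2 ^ f * (2 * d) ^ f) = (4 * (n * n) * (2 * (2 * d))) ^ f by
    rewrite -!expnMn.
  move=> h; apply: leq_trans (_ : _ <= (4 * (n * n) * (2 * (2 * d))) ^ f) _.
    by apply: leq_trans h; apply: eq_leq; rewrite -!mulnA; congr (_ * _); rewrite mulnA mulnC.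
  by rewrite -!expnMn leq_exp2r // /f; nia.
set bad := #|_|.
have e4 : bad * 4 ^ i <= (8 * K) ^ f * 2 ^ n * M.
  have p : 0 < n ^ f by rewrite expn_gt0 n0.
  rewrite -(leq_pmul2r p) -mulnA; apply: leq_trans e1 _.
  apply: leq_trans (leq_mul e2 (leqnn _)) _.
  have := leq_mul e3 (leqnn (2 ^ n * M)).
  move: ('C(n * n, f)) (2 ^ f) ((2 * d) ^ f) ((8 * K) ^ f) (n ^ f) (2 ^ n) => c1 c2 c3 c4 c5 c6 h.
  have -> : c1 * (c2 * c6) * (M * c3) = c1 * c2 * c3 * (c6 * M) by lia.
  by apply: leq_trans h _; apply: eq_leq; lia.
(* The choice of k leaves a surplus 4^(rn), which pays both for the 2^n sets T and for the 2^n in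
   the conclusion. *)
have e5 : (8 * K) ^ f * 4 ^ (r * n) <= 4 ^ i.
  by rewrite /i /f (expnM (8 * K)) -(expnMn _ 4) (expnM 4 k) leq_exp2r.
have e6 : 2 ^ n * 2 ^ n <= 4 ^ (r * n).
  by rewrite -expnMn leq_exp2l //; nia.
have q1 : 0 < (8 * K) ^ f by rewrite expn_gt0; apply/orP; left; lia.
have q2 : 0 < 2 ^ n by rewrite expn_gt0.
have h7 : bad * ((8 * K) ^ f * (2 ^ n * 2 ^ n)) <= (8 * K) ^ f * 2 ^ n * M.
  apply: leq_trans e4; rewrite leq_mul2l; apply/orP; right; apply: leq_trans e5.
  by rewrite leq_mul2l e6 orbT.
have q3 : 0 < (8 * K) ^ f * 2 ^ n by rewrite muln_gt0 q1.
rewrite -(leq_pmul2l q3); apply: leq_trans h7; apply: eq_leq; lia.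
Qed.
End Events.

(** * Transversals of a pairing *)

Section LocalLemma.
Variables (I V : finType).
Notation Om := {ffun I -> bool}.

Definition depends_on (A : {set Om}) (S : {set I}) :=
  forall w w' : Om, {in S, w =1 w'} -> (w \in A) = (w' \in A).

(** Independence as an injection: exchanging the coordinates in S between two assignments maps (A
    and Z) times everything into A times Z. *)
Lemma indep_card (A Z : {set Om}) S : depends_on A S -> depends_on Z (~: S) ->
  #|A :&: Z| * #|{: Om}| <= #|A| * #|Z|.
Proof.
move=> hA hZ.
pose mix (w w' : Om) : Om := [ffun i => if i \in S then w i else w' i].
pose f (p : Om * Om) := (mix p.1 p.2, mix p.2 p.1).
have fi : injective f.
  move=> [a b] [a' b'] [/ffunP e1 /ffunP e2].
  by congr (_, _); apply/ffunP=> i; move: (e1 i) (e2 i); rewrite !ffunE; case: ifP.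
rewrite -cardsT -!cardsX -(card_imset _ fi); apply: subset_leq_card.
apply/subsetP=> q /imsetP[[w w']]; rewrite !inE /= andbT => /andP[wA wZ] ->.
rewrite /= (hA _ w) ?wA /=; last by move=> i iS; rewrite ffunE iS.
by rewrite (hZ _ w) // => i; rewrite inE ffunE => /negbTE ->.
Qed.

Variables (A : V -> {set Om}) (S : V -> {set I}) (q D : nat).
Hypothesis Adep : forall v, depends_on (A v) (S v).
Hypothesis Aq : forall v, #|A v| * q <= #|{: Om}|.
Hypothesis SD : forall v, #|[set u | (u != v) && ~~ [disjoint S u & S v]]| <= D.
Hypothesis q4 : 4 * D <= q.
Hypothesis q2 : 2 < q.

Definition avoid (U : {set V}) : {set Om} := [set w | [forall u in U, w \notin A u]].

Lemma avoidP (U : {set V}) (w : Om) : reflect (forall u, u \in U -> w \notin A u) (w \in avoid U).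
Proof. by rewrite inE; exact: forall_inP. Qed.

(** The conditional probability of A_v is at most 2/q. Events sharing no coordinate with A_v keep it
    at 1/q; the at most D others have conditional probability at most 2D/q <= 1/2 in total, so
    avoiding them too at most doubles it. *)
Lemma avoid_step (U : {set V}) v : v \notin U -> #|A v :&: avoid U| * q <= 2 * #|avoid U|.
Proof.
elim: {U}_.+1 {-2}U (ltnSn #|U|) v => // k IH U hk v vU.
pose U1 := U :&: [set u | ~~ [disjoint S u & S v]]; pose U2 := U :\: U1.
have U2U : U2 \subset U by apply: subsetDl.
have sub2 : avoid U \subset avoid U2.
  by apply/subsetP=> w /avoidP h; apply/avoidP=> u /(subsetP U2U); apply: h.
have h1 : #|A v :&: avoid U| * q <= #|avoid U2|.
  have O0 : 0 < #|{: Om}| by rewrite -cardsT card_gt0; apply/set0Pn; exists [ffun=> true];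
    rewrite inE.
  rewrite -(leq_pmul2r O0); apply: leq_trans (_ : #|A v :&: avoid U2| * #|{: Om}| * q <= _).
    by rewrite mulnAC leq_mul2r leq_mul2r subset_leq_card ?orbT // setIS.
  apply: leq_trans (_ : #|A v| * #|avoid U2| * q <= _); last first.
    by rewrite mulnAC mulnC leq_mul2l Aq orbT.
  have ind : depends_on (avoid U2) (~: S v).
    move=> w w' ww'.
    have e u : u \in U2 -> (w \in A u) = (w' \in A u).
      move=> uU2; apply: Adep => i iS; apply: ww'; rewrite inE; apply/negP=> iSv.
      by move: uU2; rewrite !inE => /andP[] /[swap] ->; rewrite negbK /= => /disjointFr /(_ iS);
        rewrite iSv.
    by apply/avoidP/avoidP=> h u uU2; move: (h u uU2); rewrite e.
  rewrite leq_mul2r; apply/orP; right; exact: indep_card (@Adep v) ind.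

apply: leq_trans h1 _.
have [U10|U1n0] := eqVneq U1 set0.
  by rewrite /U2 U10 setD0; lia.
have lt2 : #|U2| < k.
  rewrite ltnS in hk; apply: leq_trans hk; apply: proper_card; rewrite properE U2U /=.
  case/set0Pn: U1n0 => u uU1; apply/subsetPn; exists u; first by move: uU1; rewrite inE => /andP[].
  by rewrite inE uU1.
have cU1 : #|U1| <= D.
  apply: leq_trans (SD v); apply: subset_leq_card; apply/subsetP=> u.
  by rewrite !inE => /andP[uU ->]; rewrite andbT; apply: contraNneq vU => <-.
have cov : avoid U2 \subset avoid U :|: \bigcup_(u in U1) (A u :&: avoid U2).
  apply/subsetP=> w wU2; rewrite inE; case: (boolP (w \in avoid U)) => //= hw.
  move: hw; rewrite {1}inE negb_forall => /existsP[u]; rewrite negb_imply negbK => /andP[uU wA].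
  apply/bigcupP; exists u; last by rewrite inE wA.
  apply: contraLR wA => uU1; have /avoidP := wU2; apply; by rewrite inE uU1.
have hs : #|\bigcup_(u in U1) (A u :&: avoid U2)| * q <= D * (2 * #|avoid U2|).
  apply: leq_trans (_ : (\sum_(u in U1) #|A u :&: avoid U2|) * q <= _).
    by rewrite leq_mul2r leq_card_bigcup orbT.
  rewrite big_distrl /=; apply: leq_trans (_ : \sum_(u in U1) 2 * #|avoid U2| <= _).
    by apply: leq_sum => u uU1; apply: IH => //; rewrite inE uU1.
  by rewrite sum_nat_const leq_mul2r cU1 orbT.
have := subset_leq_card cov.
have := cardsU (avoid U) (\bigcup_(u in U1) (A u :&: avoid U2)).
move: #|_ :|: _| #|_ :&: _| hs => x y;
  move: #|\bigcup_(u in U1) _| #|avoid U2| #|avoid U| => b a2 a h1 h2 h3.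
have h4 : a2 * q <= a * q + b * q by rewrite -mulnDl leq_mul2r; apply/orP; right; lia.
have h5 : 2 * (D * (2 * a2)) <= q * a2 by have := leq_mul q4 (leqnn a2); lia.
have q0 : 0 < q by lia.
rewrite -(leq_pmul2r q0); lia.
Qed.

Lemma local_lemma : exists w : Om, forall v, w \notin A v.
Proof.
suff h : forall U : {set V}, 0 < #|avoid U|.
  have := h setT; rewrite card_gt0 => /set0Pn[w /avoidP hw]; exists w => v; exact: hw.
move=> U; elim: {U}_.+1 {-2}U (ltnSn #|U|) => // k IH U hk.
case: (set_0Vmem U) => [->|[v vU]].
  by rewrite card_gt0; apply/set0Pn; exists [ffun=> true]; apply/avoidP=> u; rewrite inE.
have hlt : #|U :\ v| < k by move: hk; rewrite (cardsD1 v) vU add1n ltnS.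
have h0 := IH _ hlt.
have h1 := @avoid_step (U :\ v) v (ltac:(by rewrite !inE eqxx)).
have e : avoid U = avoid (U :\ v) :\: A v.
  apply/setP=> w; rewrite in_setD; apply/avoidP/andP.
    move=> h; split; first exact: h.
    by apply/avoidP=> u; rewrite inE => /andP[_]; apply: h.
  by case=> wA /avoidP h u uU; case: (eqVneq u v) => [->//|uv]; apply: h; rewrite !inE uv.
have := cardsID (A v) (avoid (U :\ v)); rewrite -e setIC.
move: h0 h1; move: #|avoid (U :\ v)| #|A v :&: _| #|avoid U| => x y z; nia.
Qed.
End LocalLemma.

(** * Splitting all pairs while keeping degrees *)

Section Transversal.
Variables (n d : nat) (g : graph n) (m : 'I_n -> 'I_n).
Hypotheses (gr : regular d g) (mK : involutive m).

Definition representative (v : 'I_n) : 'I_n := if v <= m v then v else m v.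

Lemma representative_eq v w : representative v = representative w -> w = v \/ w = m v.
Proof.
rewrite /representative; case: ifP => _; case: ifP => _ e.
- by left.
- by right; rewrite e mK.
- by right.
- by left; apply: (can_inj mK).
Qed.

(** One bit per pair, stored at its smaller element; the exclusive or with [v < m v] gives the two
    elements opposite outcomes. *)
Definition pick_side (w : {ffun 'I_n -> bool}) : {set 'I_n} :=
  [set v | (m v == v) || (w (representative v) (+) (v < m v))].

Lemma pick_side_m w v : m v != v -> (m v \in pick_side w) = (v \notin pick_side w).
Proof.
move=> mv; rewrite !inE mK eq_sym (negbTE mv) /=.
have -> : representative (m v) = representative v.
  rewrite /representative mK; case: (ltngtP v (m v)) => // /ord_inj e; rewrite -?e //.
have : (m v < v) = ~~ (v < m v).
  by case: (ltngtP (m v) v) => // /ord_inj e; rewrite e eqxx in mv.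
by move=> ->; rewrite addbN.
Qed.

(** Where both elements of a pair are neighbours of v only the smaller is kept. At least half of the
    neighbours survive, and their bits are independent. *)
Lemma half_reps a v : 16 * a <= d ->
  exists Y : {set 'I_n}, [/\ Y \subset nbrs g v, #|Y| = 8 * a & {in Y &, injective representative}].
Proof.
move=> had; have [N eN] : exists N, N = nbrs g v by eexists.
pose N1 := [set y in N | (y <= m y) || (m y \notin N)].
have mi := can_inj mK.
have c1 : #|N :\: N1| <= #|N1|.
  rewrite -(card_imset _ mi); apply: subset_leq_card; apply/subsetP=> z /imsetP[y + ->].
  rewrite !inE mK negb_and negb_or -ltnNge negbK => /andP[+ yN]; rewrite yN /= => /andP[lt mN].
  by rewrite mN (ltnW lt).
have c2 : d <= 2 * #|N1|.
  rewrite -(card_nbrs v gr) -eN -(cardsID N1 N) mul2n -addnn leq_add //.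
  by apply: subset_leq_card; apply: subsetIr.
have h8 : #|@set0 'I_n| <= 8 * a <= #|N1| by rewrite cards0; lia.
have [Y [_ YN1 cY]] := subset_extend (sub0set N1) h8.
exists Y; split=> //; first by rewrite -eN; apply: subset_trans YN1 _; apply/subsetP=> y;
  rewrite inE => /andP[].
move=> y z /(subsetP YN1) yN /(subsetP YN1) zN e.
case: (representative_eq e) => [//|ez]; subst z.
move: yN zN; rewrite !inE mK => /andP[yN +] /andP[mN +].
by rewrite yN mN !orbF => l1 l2; apply/ord_inj/eqP; rewrite eqn_leq l1 l2.
Qed.

(* Exponential moment: each picked vertex of Y has weight 1, the others weight 3. *)
Lemma few_picked a t (Y : {set 'I_n}) : t <= a -> #|Y| = 8 * a -> {in Y &, injective
  representative} ->
  #|[set w | #|Y :&: pick_side w| < t]| * 8 ^ a <= #|{: {ffun 'I_n -> bool}}|.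
Proof.
move=> ta cY inj; set A := [set w | _].
pose c (y : 'I_n) (b : bool) := if (m y == y) || (b (+) (y < m y)) then 1 else 3.
have cE (w : {ffun 'I_n -> bool}) y : c y (w (representative y)) = if y \in pick_side w then 1
  else 3 by rewrite inE.
(* Fewer than t <= a picked elements leave more than 7a elements of weight 3. *)
have h1 : #|A| * 3 ^ (7 * a) <= \sum_(w : {ffun 'I_n -> bool}) \prod_(y in Y) c y (w
  (representative y)).
  rewrite -sum_nat_const [leqRHS](bigID (mem A)) /= -[leqLHS]addn0 leq_add //.
  apply: leq_sum => w; rewrite inE => wA.
  rewrite (bigID (mem (pick_side w))) /= big1 ?mul1n; last by move=> y /andP[_ h]; rewrite cE h.
  rewrite (eq_bigr (fun=> 3)); last by move=> y /andP[_ h]; rewrite cE (negbTE h).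
  rewrite (eq_bigl (mem (Y :\: pick_side w))); last by move=> y; rewrite !inE andbC.
  rewrite prod_nat_const leq_exp2l //.
  by have := cardsID (pick_side w) Y; lia.
have h2 : \sum_(w : {ffun 'I_n -> bool}) \prod_(y in Y) c y (w (representative y)) <= 2 ^ (8 * a)
  * 2 ^ n.
  have -> : \sum_(w : {ffun 'I_n -> bool}) \prod_(y in Y) c y (w (representative y)) =
     \sum_(w : {ffun 'I_n -> bool}) \prod_i \prod_(y in Y | representative y == i) c y (w i).
    apply: eq_bigr => w _; rewrite (partition_big representative xpredT) //=.
    by apply: eq_bigr => i _; apply: eq_bigr => y /andP[_ /eqP <-].
  rewrite -(bigA_distr_bigA (fun i b => \prod_(y in Y | representative y == i) c y b)).
  apply: leq_trans (_ : \prod_(i : 'I_n) (2 * (if i \in representative @: Y then 2 else 1)) <= _).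
    apply: leq_prod => i _; rewrite big_bool /=.
    case: ifP => [/imsetP[y yY ->]|iY].
      have e (z : 'I_n) : (z \in Y) && (representative z == representative y) = (z == y).
        apply/andP/eqP => [[zY /eqP]|->]; [exact: inj | by []].
      rewrite !(eq_bigl _ _ e) !big_pred1_eq /c.
      by case: (m y == y) => //=; case: (y < m y).
    have e y : (y \in Y) && (representative y == i) = false.
      by apply: contraFF iY => /andP[yY /eqP <-]; apply: imset_f.
    by rewrite !big_pred0.
  rewrite big_split /= prod_nat_const card_ord mulnC leq_mul2r; apply/orP; right.
  rewrite -big_mkcond /= prod_nat_const card_in_imset // cY; done.
rewrite card_ffun card_bool card_ord.
have p : 0 < 2 ^ (8 * a) by rewrite expn_gt0.
rewrite -(leq_pmul2l p); apply: leq_trans h2; apply: leq_trans h1.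
(* The numerical point is 8 * 2^8 = 2048 <= 2187 = 3^7. *)
rewrite mulnCA leq_mul2l; apply/orP; right.
by rewrite expnM -expnMn expnM; case: (a) => // b; rewrite leq_exp2r.
Qed.

(* Fixed points of m are always picked, so that T has at least n/2 vertices. *)
Lemma exists_transversal a t : t <= a -> 16 * a <= d -> 8 * d ^ 2 <= 8 ^ a -> 0 < a ->
  exists T : {set 'I_n},
    [/\ forall v, m v != v -> (m v \in T) = (v \notin T),
        forall v, m v = v -> v \in T &
        forall v, t <= #|nbrs g v :&: T|].
Proof.
move=> ta had hda a0.
have hY v : exists Y : {set 'I_n}, [&& Y \subset nbrs g v, #|Y| == 8 * a & [forall y in Y, forall
  z in Y, (representative y == representative z) ==> (y == z)]].
  have [Y [h1 /eqP h2 h3]] := half_reps v had; exists Y; rewrite h1 h2 /=.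
  apply/forall_inP=> y yY; apply/forall_inP=> z zY; apply/implyP=> /eqP e.
  by apply/eqP; apply: h3.
pose Y v := xchoose (hY v).
have YP v : [/\ Y v \subset nbrs g v, #|Y v| = 8 * a & {in Y v &, injective representative}].
  have /and3P[h1 /eqP h2 /forall_inP h3] := xchooseP (hY v); split=> // y z yY zY e.
  by have /forall_inP /(_ z zY) /implyP h := h3 y yY; apply/eqP/h/eqP.
pose A v := [set w | #|Y v :&: pick_side w| < t].
(* The events at u and v share a bit only if u is adjacent to y or [m y] for some neighbour y of v,
   whence the dependency bound 2d^2. *)
have [] := @local_lemma _ _ A (fun v => representative @: Y v) (8 ^ a) (2 * d ^ 2).
- move=> v w w' ww'; rewrite !inE; congr (_ < _); apply: eq_card => y; rewrite !inE.
  by case yY : (y \in Y v) => //=; rewrite ww' // imset_f.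
- by move=> v; have [h1 h2 h3] := YP v; apply: few_picked.
- move=> v.
  apply: leq_trans (_ : #|\bigcup_(y in nbrs g v) (nbrs g y :|: nbrs g (m y))| <= _).
    apply: subset_leq_card; apply/subsetP=> u; rewrite inE => /andP[_ /pred0Pn[i /andP[]]].
    case/imsetP=> z zY -> /imsetP[y yY e].
    have [Yu _ _] := YP u; have [Yv _ _] := YP v.
    apply/bigcupP; exists y; first exact: subsetP Yv _ yY.
    have := subsetP Yu _ zY; rewrite !inE /adj (simpleP (andP gr).1).2.
    by case: (representative_eq (esym e)) => ->  ->; rewrite ?orbT.
  apply: leq_trans (leq_card_bigcup _ _) _.
  apply: leq_trans (_ : \sum_(y in nbrs g v) (d + d) <= _).
    by apply: leq_sum => y _; rewrite cardsU !(card_nbrs _ gr) leq_subr.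
  by rewrite sum_nat_const (card_nbrs _ gr) addnn -mul2n expnS expn1 mulnCA.
- by rewrite mulnA.
- by apply: leq_trans (_ : 8 ^ 1 <= _); rewrite ?leq_exp2l.
move=> w hw; exists (pick_side w); split.
- by move=> v; apply: pick_side_m.
- by move=> v e; rewrite inE e eqxx.
- move=> v; have := hw v; rewrite inE -leqNgt => h; apply: leq_trans h _.
  by apply: subset_leq_card; apply: setSI; have [] := YP v.
Qed.
End Transversal.

(** * Hitting sets and rotations *)

(** This is (1 - 1/q)^q <= 1/2, from Bernoulli's inequality for (1 + 1/p)^k with p = q - 1 and k =
    q. *)
Lemma double_pred_exp q : 0 < q -> 2 * q.-1 ^ q <= q ^ q.
Proof.
case: q => // p _ /=; case: (posnP p) => [->//|p0].
have bern k : p ^ k * (p + k) <= p * p.+1 ^ k.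
  elim: k => [|k IH]; first by rewrite addn0 mul1n muln1.
  rewrite !expnS; have := leq_mul (leqnn p.+1) IH.
  move: (p ^ k) (p.+1 ^ k) => x y; nia.
have := bern p.+1; rewrite -(leq_pmul2l p0); move: (p ^ p.+1) (p.+1 ^ p.+1) => x y; nia.
Qed.

(* Greedy choice: some element lies in a 1/q fraction of the sets not yet hit. *)
Lemma hitting_set (X J : finType) (E : {set X}) (P : pred J) (S : J -> {set X}) q m :
  0 < q -> 0 < #|E| -> #|[set j | P j]| <= 4 ^ m ->
  (forall j, P j -> S j \subset E) -> (forall j, P j -> #|E| <= q * #|S j|) ->
  exists F : {set X}, [/\ F \subset E, #|F| <= q * (2 * m).+1 & forall j, P j -> S j :&: F != set0].
Proof.
move=> q0 E0 hP SE hS.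
pose R (F : {set X}) := [set j | P j && (S j :&: F == set0)].
have h t : exists F : {set X}, [/\ F \subset E, #|F| <= t & #|R F| * q ^ t <= #|[set j | P j]| *
  q.-1 ^ t].
  elim: t => [|t [F [FE cF hF]]].
    exists set0; rewrite sub0set cards0; split=> //; rewrite !muln1.
    by apply: subset_leq_card; apply/subsetP=> j; rewrite !inE => /andP[].
  have [e eE he] : exists2 e, e \in E & #|R F| <= q * #|[set j in R F | e \in S j]|.
    apply: contrapT => hne.
    have hlt e : e \in E -> q * #|[set j in R F | e \in S j]| < #|R F|.
      by move=> eE; rewrite ltnNge; apply/negP=> hle; apply: hne; exists e.
    have s1 : \sum_(e in E) #|[set j in R F | e \in S j]| = \sum_(j in R F) #|S j|.
      transitivity (\sum_(e in E) \sum_(j in R F) (e \in S j : nat)).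
        apply: eq_bigr => e _; rewrite -sum1_card big_mkcond [RHS]big_mkcond /=.
        by apply: eq_bigr => j _; rewrite in_set; case: (j \in R F) => //=; case: (e \in S j).
      rewrite exchange_big /=; apply: eq_bigr => j; rewrite inE => /andP[Pj _].
      rewrite -sum1_card [RHS]big_mkcond [LHS]big_mkcond /=; apply: eq_bigr => e _.
      by case eS: (e \in S j); rewrite ?(subsetP (SE _ Pj) _ eS) //; case: ifP.
    have s2 : #|R F| * #|E| <= q * \sum_(j in R F) #|S j|.
      rewrite -sum_nat_const big_distrr /=; apply: leq_sum => j; rewrite inE => /andP[Pj _].
      exact: hS.
    have s3 : \sum_(e in E) (q * #|[set j in R F | e \in S j]|).+1 <= \sum_(e in E) #|R F|.
      by apply: leq_sum => e eE; apply: hlt.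
    have s4 : \sum_(e in E) (q * #|[set j in R F | e \in S j]|).+1 = q * \sum_(j in R F) #|S j| +
      #|E|.
      by rewrite -s1 big_distrr -sum1_card -big_split /=; apply: eq_bigr => e _; rewrite addn1.
    by move: s3; rewrite s4 sum_nat_const; lia.
  exists (e |: F); split.
  - by rewrite subUset sub1set eE.
  - by apply: leq_trans (_ : #|F|.+1 <= _); rewrite // cardsU1; case: (_ \notin _).
  - have hR : #|R (e |: F)| + #|[set j in R F | e \in S j]| <= #|R F|.
      rewrite -cardsUI [X in _ + X](_ : _ = 0) ?addn0.
        apply: subset_leq_card; apply/subsetP=> j; rewrite !inE => /orP[/andP[-> /=]|/andP[-> _]//].
        by rewrite -!subset0; apply: subset_trans; apply: setIS; apply: subsetUr.
      apply/eqP; rewrite cards_eq0 -subset0; apply/subsetP=> j.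
      rewrite !inE => /andP[/andP[_ /eqP/setP/(_ e)]].
      by rewrite !inE eqxx /= andbT => ->; rewrite andbF.
    have hq : q * #|R (e |: F)| <= q.-1 * #|R F| by case: (q) q0 he => // k _; nia.
    rewrite !expnS.
    have := leq_mul (leqnn (q.-1)) hF; have := leq_mul hq (leqnn (q ^ t)).
    move: (q ^ t) (q.-1 ^ t) => x y; nia.
(* Every q rounds halve the number of sets not hit, so 2m + 1 such blocks leave less than one of
   4^m. *)
have [F [FE cF hF]] := h (q * (2 * m).+1).
exists F; split=> // j Pj; apply/negP=> SF.
have R1 : 0 < #|R F| by rewrite card_gt0; apply/set0Pn; exists j; rewrite inE Pj.
have h2 : 2 ^ (2 * m).+1 * q.-1 ^ (q * (2 * m).+1) <= q ^ (q * (2 * m).+1).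
  by rewrite (expnM q.-1 q) (expnM q q) -expnMn leq_exp2r // double_pred_exp.
have p : 0 < q ^ (q * (2 * m).+1) by rewrite expn_gt0 q0.
rewrite expnS expnM -[2 ^ 2]/4 in h2.
have := leq_mul hP (leqnn (q.-1 ^ (q * (2 * m).+1))).
have := leq_mul R1 (leqnn (q ^ (q * (2 * m).+1))).
move: h2 hF p; move: (q ^ _) (q.-1 ^ _) (4 ^ m) => x y z; nia.
Qed.

(** * Posa's rotations *)

Section Posa.
Variables (V : finType) (e : rel V).
Hypothesis esym : symmetric e.

(** The head moves and the last vertex stays: the edge xy replaces the edge from y to its
    predecessor, which becomes the new head. *)
Inductive rotation (x0 : V) (p0 : seq V) : V -> seq V -> Prop :=
| rotation0 : rotation x0 p0 x0 p0
| rotationS x a y b : rotation x0 p0 x (a ++ y :: b) -> e x y ->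
    rotation x0 p0 (last x a) (rev (belast x a) ++ y :: b).

Lemma rev_cons_last (x : V) a : last x a :: rev (belast x a) = rev (x :: a).
Proof. by rewrite [x :: a]lastI rev_rcons. Qed.

Lemma rotationP x0 p0 x p : rotation x0 p0 x p -> path e x0 p0 ->
  [/\ path e x p, perm_eq (x :: p) (x0 :: p0) & last x p = last x0 p0].
Proof.
move=> + h0; elim=> [|{}x a y b _ [h1 h2 h3] exy]; first by split.
split.
- move: h1; rewrite !cat_path /= => /and3P[h4 _ h5].
  have -> : last (last x a) (rev (belast x a)) = x.
    by case: a {h2 h3 h4} => //= z a; rewrite rev_cons last_rcons.
  by rewrite exy h5 rev_path (eq_path (e' := e)) ?h4 // => u v; rewrite esym.
- by rewrite -cat_cons rev_cons_last; apply: perm_trans h2; rewrite -cat_cons perm_cat2r perm_rev.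
- by move: h3; rewrite !last_cat.
Qed.

Definition consec (s : seq V) u v := exists l r, s = l ++ u :: v :: r.
Definition consec_sym (s : seq V) u v := consec s u v \/ consec s v u.

Lemma consec_rev s u v : consec (rev s) u v -> consec s v u.
Proof.
move=> [l [r h]]; exists (rev r), (rev l).
by rewrite -[s]revK h rev_cat !rev_cons -!cats1 -!catA.
Qed.

Lemma consec_cat s1 s2 u v : consec (s1 ++ s2) u v ->
  [\/ consec s1 u v, consec s2 u v | exists s1' s2', s1 = rcons s1' u /\ s2 = v :: s2'].
Proof.
elim: s1 => [|x s1 IH] /=; first by move=> h; apply: Or32.
move=> [[|z l] [r /= []]].
  move=> xu; case: s1 {IH} => [|z s1] /=; last first.
    by case=> zv _; apply: Or31; exists [::], s1; rewrite xu zv.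
  by move=> ->; apply: Or33; exists [::], r; rewrite xu.
move=> _ h; case: IH; first by exists l, r.
- by move=> [l' [r' ->]]; apply: Or31; exists (x :: l'), r'.
- by move=> h'; apply: Or32.
- by move=> [s1' [s2' [-> ->]]]; apply: Or33; exists (x :: s1'), s2'.
Qed.

Lemma consec_catl s1 s2 u v : consec s1 u v -> consec (s1 ++ s2) u v.
Proof. by move=> [l [r ->]]; exists l, (r ++ s2); rewrite -catA. Qed.

Lemma consec_catr s1 s2 u v : consec s2 u v -> consec (s1 ++ s2) u v.
Proof. by move=> [l [r ->]]; exists (s1 ++ l), r; rewrite -catA. Qed.

Definition reach x0 p0 : {set V} := [set x | `[< exists p, rotation x0 p0 x p >]].

Lemma reachP x0 p0 x : reflect (exists p, rotation x0 p0 x p) (x \in reach x0 p0).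
Proof. by rewrite inE; exact: asboolP. Qed.

(* Edges of the path at a vertex that is neither reached nor next to a reached vertex are never broken. *)
Lemma rotation_consec x0 p0 v x p : rotation x0 p0 x p -> v \notin reach x0 p0 ->
  (forall z, consec_sym (x0 :: p0) v z -> z \notin reach x0 p0) ->
  forall w, consec_sym (x :: p) v w -> consec_sym (x0 :: p0) v w.
Proof.
move=> + vR vN; elim=> // {}x a y b hr IH exy w.
have hz : last x a \in reach x0 p0 by apply/reachP; eexists; apply: rotationS hr exy.
have hx : x \in reach x0 p0 by apply/reachP; eexists; apply: hr.
rewrite -cat_cons rev_cons_last.
have hin u u' : consec (rev (x :: a) ++ y :: b) u u' -> consec_sym (x :: a ++ y :: b) u u' \/ (u
  = x /\ u' = y).
  rewrite -cat_cons; case/consec_cat.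
  - by move=> /consec_rev h; left; right; apply: consec_catl.
  - by move=> h; left; left; apply: consec_catr.
  - move=> [s1 [s2 [h1 [-> _]]]]; right; split=> //.
    by move: h1; rewrite rev_cons => /rcons_inj[].
have hy : v = y -> False.
  move=> vy; have : consec_sym (x :: a ++ y :: b) v (last x a).
    by right; rewrite vy -cat_cons lastI cat_rcons; exists (belast x a), b.
  by move=> /IH /vN; rewrite hz.
have nbC s u u' : consec_sym s u u' -> consec_sym s u' u by case; [right|left].
case=> /hin [].
- exact: IH.
- by move=> [vx]; move: vR; rewrite vx hx.
- by move=> /nbC; exact: IH.
- by move=> [_ /hy].
Qed.

(** Every outer neighbour of the set of reachable heads is next to a reachable head on the original
    path, and each vertex has at most two path neighbours. *)
Lemma posa x0 p0 : path e x0 p0 -> uniq (x0 :: p0) ->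
  (forall x p, rotation x0 p0 x p -> forall v, e x v -> v \in x :: p) ->
  #|[set v | (v \notin reach x0 p0) && [exists x in reach x0 p0, e x v]]| <= 2 * #|reach x0 p0|.
Proof.
move=> hp hu hmax; set R := reach x0 p0.
(* At the ends of the path [nx] and [pv] return x0; this is harmless, since only a covering of the
   outer neighbours is wanted. *)
pose nx u := nth x0 (x0 :: p0) (index u (x0 :: p0)).+1.
pose pv u := nth x0 (x0 :: p0) (index u (x0 :: p0)).-1.
have consecE u v : consec_sym (x0 :: p0) u v -> v = nx u \/ v = pv u.
  rewrite /nx /pv; case=> -[l [r h]]; rewrite h in hu *.
  - left; rewrite index_cat; have -> : (u \in l) = false.
      by apply/negP=> ul; move: hu; rewrite cat_uniq => /and3P[_ /hasPn /(_ u)];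
        rewrite inE eqxx ul => /(_ isT).
    by rewrite /= eqxx addn0 nth_cat ltnNge leqnSn /= subSn ?subnn.
  - right; rewrite index_cat; have -> : (u \in l) = false.
      by apply/negP=> ul; move: hu; rewrite cat_uniq => /and3P[_ /hasPn /(_ u)];
        rewrite !inE eqxx orbT ul => /(_ isT).
    have -> : index u [:: v, u & r] = 1.
      rewrite /= eqxx; case: eqP => // vu.
      by move: hu; rewrite cat_uniq vu /= inE eqxx /= !andbF.
    by rewrite addn1 /= nth_cat ltnn subnn.
apply: leq_trans (_ : #|nx @: R :|: pv @: R| <= _); last first.
  by apply: leq_trans (leq_card_setU _ _) _; rewrite mul2n -addnn leq_add ?leq_imset_card.
apply: subset_leq_card; apply/subsetP=> v; rewrite inE => /andP[vR /existsP[x /andP[xR exv]]].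
have [p hr] := reachP _ _ _ xR.
have vp := hmax x p hr v exv.
have vx : v != x by apply: contraNneq vR => ->.
move: vp; rewrite inE (negbTE vx) /= => vp.
case/splitPr: vp hr => a b hr.
have zR : last x a \in R by apply/reachP; eexists; apply: rotationS hr exv.
(* Otherwise the path edges at v were never broken, and rotating at v makes a head of its current
   predecessor, which is still an original neighbour of v. *)
have [z nbz zR'] : exists2 z, consec_sym (x0 :: p0) v z & z \in R.
  apply: contrapT => hne.
  have nbv : consec_sym (x :: a ++ v :: b) v (last x a).
    by right; rewrite -cat_cons lastI cat_rcons; exists (belast x a), b.
  apply: (hne); exists (last x a) => //; apply: (rotation_consec hr vR _ nbv) => z hz.
  by apply/negP=> zR'; apply: hne; exists z.
have nbz' : consec_sym (x0 :: p0) z v by case: nbz; [right|left].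
by rewrite inE; case: (consecE _ _ nbz') => ->; rewrite imset_f ?orbT.
Qed.
End Posa.

(** * Boosters and Hamilton paths *)

Section Boosters.
Variable n : nat.
Implicit Types (F : {set 'I_n * 'I_n}) (T S : {set 'I_n}) (x y u v : 'I_n) (p : seq 'I_n).

Definition erel F T : rel 'I_n := fun x y => [&& x \in T, y \in T & ((x, y) \in F) || ((y, x) \in
  F)].

Lemma erel_sym F T : symmetric (erel F T).
Proof. by move=> x y; rewrite /erel andbCA orbC. Qed.

Lemma erel_mono F F' T : F \subset F' -> subrel (erel F T) (erel F' T).
Proof.
by move=> /subsetP FF' x y /and3P[xT yT /orP[] /FF' h]; rewrite /erel xT yT h ?orbT.
Qed.

Definition tpath F T x p := [&& x \in T, path (erel F T) x p & uniq (x :: p)].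

Definition maxpath F T x p := tpath F T x p /\ forall x' p', tpath F T x' p' -> size p' <= size p.

(* Adding a booster closes a longest path to a cycle. *)
Definition boosters F T : {set 'I_n * 'I_n} :=
  [set q | (q.1 != q.2) && `[< exists p, maxpath F T q.1 p /\ last q.1 p = q.2 >]].

Definition expander F T := forall S, S \subset T -> S != set0 -> 8 * #|S| <= n ->
  2 * #|S| < #|[set v | (v \notin S) && [exists x in S, erel F T x v]]|.

Lemma expander_mono F F' T : F \subset F' -> expander F T -> expander F' T.
Proof.
move=> FF' h S ST S0 S8; apply: leq_trans (h S ST S0 S8) _; apply: subset_leq_card.
apply/subsetP=> v; rewrite !inE => /andP[-> /existsP[x /andP[xS xv]]].
by apply/existsP; exists x; rewrite xS (erel_mono FF').
Qed.

Lemma tpath_sub F T x p : tpath F T x p -> {subset x :: p <= T}.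
Proof.
move=> /and3P[xT hp _]; elim: p x xT hp => [|y p IH] x xT /=.
  by move=> _ z; rewrite inE => /eqP->.
case/andP=> /and3P[_ yT _] hp z; rewrite inE => /orP[/eqP->//|]; exact: IH.
Qed.

Lemma tpath_size F T x p : tpath F T x p -> size p < #|T|.
Proof.
move=> h; have /and3P[_ _ u] := h.
rewrite -[(size p).+1]/(size (x :: p)) -(card_uniqP u); apply: subset_leq_card.
by apply/subsetP=> z; apply: (tpath_sub h).
Qed.

Lemma exists_maxpath F T : T != set0 -> exists x p, maxpath F T x p.
Proof.
case/set0Pn=> x xT.
pose P k := `[< exists x p, tpath F T x p /\ size p = k >].
have exP : exists k, P k by exists 0; apply/asboolP; exists x, [::]; rewrite /tpath xT.
have bP k : P k -> k <= #|T|.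
  by move=> /asboolP[x' [p [/tpath_size h <-]]]; apply: ltnW.
case: (ex_maxnP exP bP) => k /asboolP[x' [p [hp sp]]] hk.
by exists x', p; split=> // x1 p1 h; rewrite sp; apply: hk; apply/asboolP; exists x1, p1.
Qed.

Lemma maxpath_rotation F T x0 p0 x p : maxpath F T x0 p0 -> rotation (erel F T) x0 p0 x p ->
  maxpath F T x p /\ last x p = last x0 p0.
Proof.
move=> [h0 hm] hr; have /and3P[x0T hp0 u0] := h0.
have [h1 h2 h3] := rotationP (@erel_sym F T) hr hp0; split=> //; split.
  apply/and3P; split=> //; last by rewrite (perm_uniq h2).
  by apply: (tpath_sub h0); rewrite -(perm_mem h2) mem_head.
by move=> x' p' /hm h; have /perm_size /= [->] := h2.
Qed.

Lemma maxpath_rev F T x p : maxpath F T x p ->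
  maxpath F T (last x p) (rev (belast x p)) /\ last (last x p) (rev (belast x p)) = x.
Proof.
move=> [h hm]; have /and3P[xT hp u] := h; split; last first.
  by case: (p) => //= z a; rewrite rev_cons last_rcons.
split; last by move=> x' p'; rewrite size_rev size_belast; exact: hm.
apply/and3P; split.
- by apply: (tpath_sub h); exact: mem_last.
- by rewrite rev_path (eq_path (e' := erel F T)) // => a b; rewrite erel_sym.
- by rewrite rev_cons_last rev_uniq.
Qed.

Lemma maxpath_closed F T x p v : maxpath F T x p -> erel F T x v -> v \in x :: p.
Proof.
move=> [/and3P[xT hp u] hm] xv; apply: contraT => vp.
have /hm : tpath F T v (x :: p).
  by rewrite /tpath /= erel_sym xv hp /= vp /=; move: u xv => /= -> /and3P[_ -> _].
by rewrite /= ltnn.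
Qed.

Definition ends F T z := [set x | `[< exists p, maxpath F T x p /\ last x p = z >]].

(** If at most n/8 heads were reachable, expansion of that set would contradict [posa]. *)
Lemma card_ends F T x p : expander F T -> maxpath F T x p -> n < 8 * #|ends F T (last x p)|.
Proof.
move=> hE hm; have [/and3P[xT hp hu] _] := hm.
set R := reach (erel F T) x p.
have RE : R \subset ends F T (last x p).
  apply/subsetP=> y /reachP[q /(maxpath_rotation hm) h].
  by rewrite inE; apply/asboolP; exists q.
apply: leq_trans (_ : _ <= 8 * #|R|) _; last by rewrite leq_mul2l subset_leq_card.
rewrite ltnNge; apply/negP=> R8.
have RT : R \subset T.
  apply/subsetP=> y /reachP[q /(maxpath_rotation hm) [[/and3P[] ]]]; done.
have R0 : R != set0 by apply/set0Pn; exists x; apply/reachP; exists p; constructor.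
have := hE R RT R0 R8; rewrite ltnNge => /negP; apply.
apply: (posa hp hu).
by move=> y q /(maxpath_rotation hm) [h _] v; apply: maxpath_closed.
Qed.

Lemma maxpath_ends F T x p : expander F T -> 7 < n -> maxpath F T x p -> x != last x p.
Proof.
move=> hE n8 hm; have [/and3P[xT hp hu] _] := hm.
have h1 : [set x] \subset T by rewrite sub1set.
have h2 : [set x] != set0 by apply/set0Pn; exists x; rewrite inE.
have h3 : 8 * #|[set x]| <= n by rewrite cards1.
have := hE _ h1 h2 h3; rewrite cards1 => h4.
have /card_gt0P[v] := leq_trans (isT : 0 < 3) h4.
rewrite !inE => /andP[vx /existsP[y /andP[]]]; rewrite inE => /eqP-> /(maxpath_closed hm).
rewrite inE (negbTE vx) /=; case: p hu {hm hp} => //= y' p /andP[xp _] _.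
by apply: contraNneq xp => ->; apply: mem_last.
Qed.

(** Rotate with one end fixed, then reverse each resulting longest path and rotate its other end:
    n/8 choices each time. *)
Lemma card_boosters F T : T != set0 -> 7 < n -> expander F T -> n ^ 2 <= 64 * #|boosters F T|.
Proof.
move=> T0 n8 hE; have [x [p hm]] := exists_maxpath F T0.
set z := last x p.
have h1 := card_ends hE hm.
pose B := [set q : 'I_n * 'I_n | (q.1 \in ends F T z) && (q.2 \in ends F T q.1)].
have h2 y : y \in ends F T z -> n <= 8 * #|ends F T y|.
  rewrite inE => /asboolP[q [hq lq]]; have [hr lr] := maxpath_rev hq.
  by have := card_ends hE hr; rewrite lr => /ltnW.
have BB : B \subset [set q | (q.2, q.1) \in boosters F T].
  apply/subsetP=> -[y w]; rewrite !inE /= => /andP[_ /asboolP[q [hq lq]]].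
  rewrite -lq (maxpath_ends hE n8 hq) /=; apply/asboolP.
  exact: ex_intro _ q (conj hq erefl).
have -> : #|boosters F T| = #|[set q | (q.2, q.1) \in boosters F T]| by rewrite -[LHS]card_revset.
apply: leq_trans (_ : 64 * #|B| <= _); last by rewrite leq_mul2l subset_leq_card.
rewrite card_fibers (_ : 64 = 8 * 8) // -mulnA big_distrr /=.
apply: leq_trans (_ : 8 * \sum_(a in ends F T z) n <= _).
  by rewrite sum_nat_const mulnA -mulnn leq_mul2r (ltnW h1) orbT.
by rewrite leq_mul2l; apply/orP; right; apply: leq_sum.
Qed.

Definition connected_in F T := forall S, S \subset T -> S != set0 -> S != T ->
  exists u v, [/\ u \in S, v \in T, v \notin S & erel F T u v].

(** The new edge closes the path to a cycle; connectedness gives an edge leaving it, and the cycle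
    is opened where that edge is attached. *)
Lemma boost_path F F' T x p : maxpath F T x p -> F \subset F' -> erel F' T (last x p) x ->
  connected_in F' T -> (size p).+1 < #|T| -> exists y q, tpath F' T y q /\ size q = (size p).+1.
Proof.
move=> [hp _] FF' hlast hc hsz; have /and3P[xT hpp u] := hp.
have c1 : cycle (erel F' T) (x :: p).
  by rewrite /= rcons_path hlast andbT; apply: sub_path hpp; apply: erel_mono.
have cS : #|[set z in x :: p]| = (size p).+1 by rewrite cardsE (card_uniqP u).
have [] := hc [set z in x :: p].
- by apply/subsetP=> z; rewrite inE; apply: (tpath_sub hp).
- by apply/set0Pn; exists x; rewrite inE mem_head.
- by apply: contraTneq hsz => <-; rewrite cS ltnn.
move=> w [v [wS vT vS wv]]; rewrite inE in wS; rewrite inE in vS.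
have [i s' hs'] := rot_to wS.
exists v, (w :: s').
have ss : size s' = size p by have := size_rot i (x :: p); rewrite hs' => -[].
split; last by rewrite /= ss.
have c2 : cycle (erel F' T) (w :: s') by rewrite -hs' rot_cycle.
have u2 : uniq (w :: s') by rewrite -hs' rot_uniq.
apply/and3P; split=> //; last by rewrite /= -hs' mem_rot vS -/(uniq (w :: s')).
rewrite /= erel_sym wv /=; move: c2; rewrite /= rcons_path => /andP[]; done.
Qed.

(** A booster lengthens the longest path by one, so at most n are added and |F| never exceeds f;
    expansion and connectedness pass from F0 to larger F. *)
Lemma hamilton_path g F0 T f : simple_graph g ->
  F0 \subset upedges g -> #|F0| + n <= f -> T != set0 -> 7 < n ->
  expander F0 T -> connected_in F0 T -> meets_boosters f boosters g ->
  exists x p, [/\ path (adj g) x p, uniq (x :: p) & [set z in x :: p] = T].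
Proof.
move=> gsim F0E cF0 T0 n8 hE hC hB.
have [_ gs] := simpleP gsim.
have key k : exists F x p, [/\ F0 \subset F, F \subset upedges g, #|F| <= #|F0| + k, tpath F T x p &
    (k <= size p) || (#|T| == (size p).+1)].
  elim: k => [|k [F [x [p [FF0 FE cF hp hk]]]]].
    have /set0Pn[x xT] := T0; exists F0, x, [::]; rewrite addn0; split=> //.
    by rewrite /tpath xT.
  case: (leqP k.+1 (size p)) => hkp.
    by exists F, x, p; split=> //; rewrite ?hkp // addnS ltnW.
  have [eT|neT] := eqVneq #|T| (size p).+1.
    by exists F, x, p; split; rewrite ?eT ?eqxx ?orbT // addnS ltnW.
  rewrite (negbTE neT) orbF in hk.
  have [x1 [p1 hm]] := exists_maxpath F T0.
  have hs1 : size p <= size p1 by case: hm => _; apply; exact: hp.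
  case: (leqP k.+1 (size p1)) => hkp1.
    exists F, x1, p1; split; rewrite ?hkp1 // ?addnS; first exact: ltnW.
    by case: hm.
  have hsz1 : size p1 = size p by lia.
  have hsT : (size p1).+1 < #|T|.
    by rewrite ltn_neqAle hsz1 eq_sym neT /=; apply: tpath_size hp.
  case: (posnP (n - (size p).+1)) => [|kn].
    by have := max_card T; rewrite card_ord; lia.
  have cFf : #|F| <= f by apply: leq_trans cF _; apply: leq_trans cF0; rewrite leq_add2l; lia.
  have := forallP (forallP hB F) T; rewrite FE cFf card_boosters //=; last exact: expander_mono hE.
  case/set0Pn=> -[a b]; rewrite !inE /= => /andP[gab /andP[ab /asboolP[q [hq lq]]]].
  pose c := if a < b then (a, b) else (b, a).
  have cE : c \in upedges g.
    rewrite /c; case: ltnP => h; rewrite !inE /=; first by rewrite gab h.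
    by rewrite gs gab ltn_neqAle eq_sym ab h.
  have FF' : F \subset c |: F by apply: subsetUr.
  have [] := @boost_path F (c |: F) T a q hq FF'.
  - have [/tpath_sub hsub _] := hq.
    rewrite lq /erel -lq !hsub ?mem_head ?mem_last //= lq !inE /c.
    by case: ifP => _; rewrite eqxx ?orbT.
  - move=> S h1 h2 h3; have [u [v [h4 h5 h6 h7]]] := hC S h1 h2 h3.
    by exists u, v; split=> //; apply: erel_mono h7; apply: subset_trans FF0 FF'.
  - have -> // : size q = size p1.
    by apply/eqP; rewrite eqn_leq; case: hq hm => [hq1 hq2] [hm1 hm2];
      rewrite (hm2 _ _ hq1) (hq2 _ _ hm1).
  move=> y [q' [hq' sq']]; exists (c |: F), y, q'; split=> //.
  - exact: subset_trans FF0 FF'.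
  - by rewrite subUset sub1set cE.
  - by rewrite cardsU1 addnS; case: (_ \notin _); rewrite ?add1n ?ltnS ?add0n // ltnW.
  - rewrite sq'; have -> : size q = size p; last by rewrite ltnS hk.
    rewrite -hsz1; by apply/eqP; rewrite eqn_leq; case: hq hm => [hq1 hq2] [hm1 hm2];
      rewrite (hm2 _ _ hq1) (hq2 _ _ hm1).
have [F [x [p [_ FE _ hp hk]]]] := key n.
have hT : #|T| = (size p).+1.
  case/orP: hk => [hn|/eqP//].
  have := tpath_size hp; have := max_card T; rewrite card_ord; lia.
have /and3P[_ hpp u] := hp.
exists x, p; split=> //.
  apply: sub_path hpp => a b /and3P[_ _ /orP[] /(subsetP FE)]; rewrite !inE => /andP[h _] //.
  by rewrite /adj gs.
apply/eqP; rewrite eqEcard hT cardsE (card_uniqP u) leqnn andbT.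
by apply/subsetP=> z; rewrite inE; apply: (tpath_sub hp).
Qed.
End Boosters.

(** * Sparse expanding subgraphs *)

Section Skeleton.
Variables (n d : nat) (g : graph n).
Hypothesis gr : regular d g.
Implicit Types (A H F : {set 'I_n * 'I_n}) (S T : {set 'I_n}).

Definition orient (q : 'I_n * 'I_n) := if q.1 < q.2 then q else (q.2, q.1).

Lemma orient_upedges A : A \subset edges g -> orient @: A \subset upedges g.
Proof.
move=> /subsetP AE; apply/subsetP=> _ /imsetP[[x y] /AE xyE ->].
have := edges_irr gr xyE; rewrite neq_ltn /orient /= inE.
by case: ifP => [-> _|_ /= ->]; rewrite ?(edges_sym y x gr) xyE.
Qed.

Lemma orient_erel A F T x y : orient @: A \subset F -> (x, y) \in A -> x \in T -> y \in T -> erel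
  F T x y.
Proof.
move=> /subsetP AF xyA xT yT; have /AF := imset_f orient xyA.
by rewrite /erel xT yT /orient /=; case: ifP => _ ->; rewrite ?orbT.
Qed.

Lemma card_orient A : #|A| <= 2 * #|orient @: A|.
Proof.
rewrite mul2n -addnn -[X in _ + X]card_revset.
apply: leq_trans (leq_card_setU _ _); apply: subset_leq_card; apply/subsetP=> -[x y] xyA.
have := imset_f orient xyA; rewrite !inE /orient /=.
by case: ifP => _ ->; rewrite ?orbT.
Qed.

(** Suppose S has at most 2|S| outer neighbours N. If |S| < n/h, the 6r|S| ordered pairs of A
    leaving S lie inside the at most 3|S| vertices of S and N, giving at least 3r|S| edges, against
    [sparse_small]. If |S| >= n/h, no pair of H joins S to the rest of T, so that rest is smaller
    than n/h < n/16, and 3n/8 + n/16 < n/2 contradicts the size of T. *)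
Lemma expander_skeleton T A H F r K h : 0 < r ->
  A \subset edges g -> orient @: A \subset F -> orient @: H \subset F ->
  sparse_small r K g -> 96 * K <= h -> 16 < h -> n <= 2 * #|T| -> 
  (forall v, v \in T -> #|[set w in T | (v, w) \in A]| = 6 * r) ->
  (forall S S' : {set 'I_n}, [disjoint S & S'] -> S \subset T -> S' \subset T ->
     n <= h * #|S| -> n <= h * #|S'| -> exists x y, [/\ x \in S, y \in S' & (x, y) \in H]) ->
  expander F T.
Proof.
move=> r0 AE AF HF hsp hK h16 nT cA hH S ST S0 S8; rewrite ltnNge.
set N := [set v | _]; apply/negP=> cN.
have S1 : 0 < #|S| by rewrite card_gt0.
have [hS|hS] := leqP n (h * #|S|).
  pose B := T :\: (S :|: N).
  have hB : h * #|B| < n.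
    rewrite ltnNge; apply/negP=> hB.
    have dis : [disjoint S & B].
      by rewrite disjoint_sym disjoints_subset; apply/subsetP=> x;
        rewrite !inE => /andP[/norP[-> _] _].
    have [x [y [xS yB xyH]]] := hH S B dis ST (subsetDl _ _) hS hB.
    move: yB; rewrite inE in_setU negb_or => /andP[/andP[yS yN] yT].
    move: yN; rewrite inE yS /= => /existsP; apply; exists x; rewrite xS /=.
    exact: orient_erel HF xyH (subsetP ST x xS) yT.
  have cT : #|T| <= #|S| + #|N| + #|B|.
    rewrite -(cardsID (S :|: N) T) leq_add2r; apply: leq_trans (leq_card_setU S N).
    by rewrite subset_leq_card // subsetIr.
  have := leq_mul h16 (leqnn #|B|); move: cT hB cN nT S8; clear; lia.
pose W := S :|: N.
have cW : #|W| <= 3 * #|S| by apply: leq_trans (leq_card_setU _ _) _; move: cN; clear; lia.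
have W0 : W != set0 by apply: contraNneq S0 => W0; rewrite -subset0 -W0 subsetUl.
pose C := [set q : 'I_n * 'I_n | (q.1 \in S) && (q.2 \in [set w in T | (q.1, w) \in A])].
have cC : #|C| = #|S| * (6 * r).
  by apply: (card_fibers_const (R := fun v => [set w in T | (v, w) \in A])) => v /(subsetP ST) /cA.
have CA : C \subset A by apply/subsetP=> -[x y]; rewrite !inE /= => /and3P[].
have CW : C \subset setX W W.
  apply/subsetP=> -[x y]; rewrite inE => /andP[/= xS]; rewrite inE => /andP[yT xyA].
  rewrite in_setX !in_setU xS /=; case: (boolP (y \in S)) => //= yS.
  rewrite inE yS /=; apply/existsP; exists x; rewrite xS /=.
  exact: orient_erel AF xyA (subsetP ST x xS) yT.
have sub : orient @: C \subset upedges g :&: setX W W.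
  rewrite subsetI orient_upedges ?(subset_trans CA) //=.
  apply/subsetP=> _ /imsetP[[x y] /(subsetP CW) + ->]; rewrite !in_setX /orient /= => /andP[xW yW].
  by case: ifP => _; rewrite in_setX ?xW ?yW.
have := forallP hsp W; rewrite W0 /= => /implyP hW.
have hW2 : 32 * K * #|W| <= n.
  apply: leq_trans (ltnW hS); apply: leq_trans (_ : 96 * K * #|S| <= _).
    have -> : 96 * K = 32 * K * 3 by clear; lia.
    by rewrite -[leqRHS]mulnA leq_mul2l cW orbT.
  by rewrite leq_mul2r hK orbT.
have := hW hW2; have := subset_leq_card sub; have := card_orient C; rewrite cC.
have := leq_mul (leqnn r) cW.
have -> : #|S| * (6 * r) = 2 * (r * (3 * #|S|)) by clear; lia.
move: (r * (3 * #|S|)) (r * #|W|) (#|_ :&: _|) (#|orient @: C|) => x y a b; clear; lia.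
Qed.

(** If S or its complement in T has at most n/8 vertices, expansion gives a crossing edge; otherwise
    H does. *)
Lemma connected_skeleton T H F h : orient @: H \subset F -> 8 <= h -> expander F T ->
  (forall S S' : {set 'I_n}, [disjoint S & S'] -> S \subset T -> S' \subset T ->
     n <= h * #|S| -> n <= h * #|S'| -> exists x y, [/\ x \in S, y \in S' & (x, y) \in H]) ->
  connected_in F T.
Proof.
move=> HF h8 hE hH S ST S0 neST.
have D0 : T :\: S != set0.
  by rewrite setD_eq0; apply: contraNN neST => TS; rewrite eqEsubset ST TS.
have DT : T :\: S \subset T by apply: subsetDl.
have [hS|hS] := leqP (8 * #|S|) n.
  have := hE S ST S0 hS => /(leq_ltn_trans (leq0n _)) /card_gt0P[v].
  rewrite inE => /andP[vS /existsP[u /andP[uS uv]]]; exists u, v; split=> //.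
  by case/and3P: uv.
have [hD|hD] := leqP (8 * #|T :\: S|) n.
  have := hE _ DT D0 hD => /(leq_ltn_trans (leq0n _)) /card_gt0P[v].
  rewrite inE => /andP[vD /existsP[u /andP[uD uv]]].
  have /and3P[_ vT _] := uv; move: vD; rewrite inE vT andbT negbK => vS.
  by exists v, u; move: uD; rewrite inE => /andP[uS uT]; split=> //; rewrite erel_sym.
have [|||||x [y [xS yD xyH]]] := hH S (T :\: S) => //.
- by rewrite disjoint_sym disjoints_subset; apply/subsetP=> x; rewrite !inE => /andP[].
- by apply: leq_trans (ltnW hS) _; rewrite leq_mul2r h8 orbT.
- by apply: leq_trans (ltnW hD) _; rewrite leq_mul2r h8 orbT.
move: yD; rewrite inE => /andP[yS yT]; exists x, y; split=> //.
exact: orient_erel HF xyH (subsetP ST x xS) yT.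
Qed.

(** Origin of 7rn: 6rn for the chosen neighbours, 3qn for the hitting set, n for the boosters still
    to be added, with 3q + 1 <= r. *)
Lemma transversal_path m r K h i a q : 
  7 < n -> 0 < d -> 0 < r -> 0 < q ->
  6 * r <= a -> 16 * a <= d -> 8 * d ^ 2 <= 8 ^ a -> 96 * K <= h -> 16 < h ->
  n * d <= q * (4 * i) -> 3 * q + 1 <= r ->
  sparse_small r K g -> joined h (4 * i) g -> meets_boosters (7 * (r * n)) (@boosters n) g ->
  involutive m ->
  exists x p, [/\ path (adj g) x p, uniq (x :: p) &
     forall v, m v != v -> (m v \in x :: p) = (v \notin x :: p)].
Proof.
move=> n8 d0 r0 q0 ra ad hda hK h16 hq rq hsp hj hB mK.
have [T [Tm Tf Td]] := exists_transversal gr mK ra ad hda (leq_trans (ltac:(lia) : 0 < 6 * r) ra).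
have nT : n <= 2 * #|T|.
  rewrite -[X in X <= _]card_ord -cardsT -(cardsID T setT) setTI setTD mul2n -addnn leq_add2l.
  rewrite -(card_imset _ (can_inj mK)); apply: subset_leq_card.
  apply/subsetP=> _ /imsetP[v + ->]; rewrite inE => vT.
  by rewrite Tm //; apply: contraNneq vT => /Tf.
have T0 : T != set0 by rewrite -card_gt0; lia.
have hN v : exists N : {set 'I_n}, (N \subset nbrs g v :&: T) && (#|N| == 6 * r).
  have h0 : #|@set0 'I_n| <= 6 * r <= #|nbrs g v :&: T| by rewrite cards0 Td.
  by have [N [_ h1 h2]] := subset_extend (sub0set (nbrs g v :&: T)) h0; exists N;
    rewrite h1 h2 eqxx.
pose N v := xchoose (hN v).
have NP v : (N v \subset nbrs g v :&: T) /\ #|N v| = 6 * r by have /andP[h1 /eqP h2] := xchooseP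
  (hN v).
pose A := [set q : 'I_n * 'I_n | (q.1 \in T) && (q.2 \in N q.1)].
have AE : A \subset edges g.
  apply/subsetP=> -[x y]; rewrite inE => /andP[/= _ yN].
  by have [/subsetP /(_ _ yN)] := NP x; rewrite !inE => /andP[].
have cA : #|A| <= 6 * r * n.
  rewrite (card_fibers_const (l := 6 * r)) => [|v _]; last by case: (NP v).
  by rewrite mulnC leq_mul2l -[X in _ <= X]card_ord max_card orbT.
pose P (p : {set 'I_n} * {set 'I_n}) := [&& [disjoint p.1 & p.2], n <= h * #|p.1| & n <= h *
  #|p.2|].
(* Between two large sets lie at least a 1/q fraction of all nd ordered edges, and there are at most
   4^n pairs of sets. *)
have [] := @hitting_set _ _ (edges g) P (fun p => edges g :&: setX p.1 p.2) q n q0.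
- by rewrite (card_edges gr) muln_gt0 d0; lia.
- apply: leq_trans (max_card _) _; rewrite card_prod.
  by rewrite -cardsT -powersetT card_powerset cardsT card_ord -expnD addnn -mul2n expnM.
- by move=> p _; apply: subsetIl.
- move=> [S S'] PS; rewrite (card_edges gr); apply: leq_trans hq _; rewrite leq_mul2l.
  by have := forallP (forallP hj S) S' => /implyP /(_ PS) /ltnW ->; rewrite orbT.
move=> H [HE cH hH].
pose F := orient @: A :|: orient @: H.
have AF : orient @: A \subset F by apply: subsetUl.
have HF : orient @: H \subset F by apply: subsetUr.
have hH' S S' : [disjoint S & S'] -> S \subset T -> S' \subset T ->
     n <= h * #|S| -> n <= h * #|S'| -> exists x y, [/\ x \in S, y \in S' & (x, y) \in H].
  move=> dis _ _ hS hS'; have /hH : P (S, S') by rewrite /P dis hS hS'.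
  case/set0Pn=> -[x y]; rewrite !inE /= => /andP[/and3P[_ xS yS'] xyH]; by exists x, y.
have cAT v : v \in T -> #|[set w in T | (v, w) \in A]| = 6 * r.
  move=> vT; have [Nsub <-] := NP v; apply: eq_card => w; rewrite !inE vT /=.
  by case wN: (w \in N v); rewrite ?andbF //; have := subsetP Nsub w wN; rewrite inE => /andP[_ ->].
have hE : expander F T by apply: (expander_skeleton r0 AE AF HF hsp hK h16 nT cAT hH').
have hC : connected_in F T by apply: (connected_skeleton HF _ hE hH'); apply: ltnW;
  apply: leq_trans h16.
have [] := @hamilton_path n g F T (7 * (r * n)) (andP gr).1 _ _ T0 n8 hE hC hB.
- by rewrite subUset !orient_upedges.
- have q3 : (2 * n).+1 <= 3 * n by move: n8; clear; lia.
  have cF : #|F| <= 6 * r * n + q * (3 * n).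
    apply: leq_trans (leq_card_setU _ _) _; apply: leq_add.
      exact: leq_trans (leq_imset_card _ _) cA.
    by apply: leq_trans (leq_imset_card _ _) (leq_trans cH _); rewrite leq_mul2l q3 orbT.
  have := leq_mul rq (leqnn n); move: cF; clear.
  by move: #|F| => f; rewrite mulnDl; nia.
move=> x [p [h1 h2 h3]]; exists x, p; split=> // v mv.
have e z : (z \in x :: p) = (z \in T) by rewrite -h3 in_set.
by rewrite !e Tm.
Qed.
End Skeleton.

(* Among the class-preserving involutions, take one with fewest fixed points. *)
Lemma exists_pairing (V : finType) (C : eqType) (f : V -> C) :
  exists m : V -> V, [/\ involutive m, forall v, f (m v) = f v &
    forall u v, f u = f v -> m u = u -> m v = v -> u = v].
Proof.
suff key k (m : V -> V) : involutive m -> (forall v, f (m v) = f v) -> #|[set v | m v == v]| <= k ->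
  exists m : V -> V, [/\ involutive m, forall v, f (m v) = f v &
    forall u v, f u = f v -> m u = u -> m v = v -> u = v].
  by apply: (@key _ id _ _ (leqnn _)).
elim: k m => [|k IH] m mK fm hk.
  exists m; split=> // u v _ mu _; move: hk; rewrite leqn0 cards_eq0 => /eqP /setP /(_ u).
  by rewrite !inE mu eqxx.
case: (boolP [exists u, exists v, [&& f u == f v, m u == u, m v == v & u != v]]); last first.
  move=> h; exists m; split=> // u v fuv mu mv; apply/eqP; apply: contraNT h => uv.
  by apply/existsP; exists u; apply/existsP; exists v; rewrite fuv mu mv uv !eqxx.
case/existsP=> u /existsP[v /and4P[/eqP fuv /eqP mu /eqP mv uv]].
pose m' x := if x == u then v else if x == v then u else m x.
have m'K : involutive m'.
  move=> x; rewrite /m'; case: (eqVneq x u) => [->|xu]; first by rewrite eq_sym (negbTE uv) eqxx.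
  case: (eqVneq x v) => [->|xv]; first by rewrite eqxx.
  have -> : (m x == u) = false by apply/negP=> /eqP e; move: xu; rewrite -(mK x) e mu eqxx.
  have -> : (m x == v) = false by apply/negP=> /eqP e; move: xv; rewrite -(mK x) e mv eqxx.
  exact: mK.
apply: (IH m') => //.
  by move=> x; rewrite /m'; case: eqP => [->//|_]; case: eqP => [->|].
rewrite -ltnS; apply: leq_trans hk; apply: proper_card; apply/properP; split.
  apply/subsetP=> x; rewrite !inE /m'; case: (eqVneq x u) => [->|xu];
    first by rewrite eq_sym (negbTE uv).
  by case: (eqVneq x v) => [->|//]; rewrite (negbTE uv).
by exists u; rewrite !inE ?mu ?eqxx // /m' eqxx eq_sym.
Qed.

(** * Separating systems from transversal paths *)

Section Separate.
Variables (n : nat) (g : graph n).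

Lemma path_setI x p : path (adj g) x p -> uniq (x :: p) -> is_path_set g [set z in x :: p].
Proof.
move=> hp hu; have sz : size (x :: p) == #|[set z in x :: p]| by rewrite cardsE (card_uniqP hu).
by apply/existsP; exists (Tuple sz) => /=; rewrite hp /= eqxx andbT; move: hu => /= ->.
Qed.

Definition signature (F : seq {set 'I_n}) (v : 'I_n) : seq bool := [seq v \in A | A : {set 'I_n}
  <- F].

(** At most one vertex of C is unpaired, so the two parts differ by at most 1; their sum is at most
    the even number 2^(j+1), hence neither exceeds 2^j. *)
Lemma class_half (C T : {set 'I_n}) (m : 'I_n -> 'I_n) j : involutive m ->
  (forall v, v \in C -> m v \in C) -> (forall v, m v != v -> (m v \in T) = (v \notin T)) ->
  (forall u v, u \in C -> v \in C -> m u = u -> m v = v -> u = v) ->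
  #|C| <= 2 ^ j.+1 -> #|C :&: T| <= 2 ^ j /\ #|C :\: T| <= 2 ^ j.
Proof.
move=> mK mC mT mfix cC.
have gen (A B : {set 'I_n}) : A \subset C -> (forall v, v \in A -> m v != v -> m v \in B) -> #|A|
  <= #|B| + 1.
  move=> AC hAB; rewrite -(cardsID [set v | m v == v] A) addnC leq_add //.
    rewrite -(card_imset _ (can_inj mK)); apply: subset_leq_card.
    by apply/subsetP=> _ /imsetP[v + ->]; rewrite !inE => /andP[mv vA]; apply: hAB.
  case: (set_0Vmem (A :&: [set v | m v == v])) => [->|[u]]; first by rewrite cards0.
  rewrite !inE => /andP[uA /eqP mu]; rewrite -(cards1 u); apply: subset_leq_card.
  apply/subsetP=> v; rewrite !inE => /andP[vA /eqP mv]; apply/eqP/mfix => //; exact: subsetP AC _ _.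
have h1 := gen (C :&: T) (C :\: T) (subsetIl _ _).
have h2 := gen (C :\: T) (C :&: T) (subsetDl _ _).
have {}h1 : #|C :&: T| <= #|C :\: T| + 1.
  by apply: h1 => v; rewrite !inE => /andP[vC vT] mv; rewrite mT // vT mC.
have {}h2 : #|C :\: T| <= #|C :&: T| + 1.
  by apply: h2 => v; rewrite !inE => /andP[vT vC] mv; rewrite mT // vT mC.
have := cardsID T C; rewrite expnS in cC; lia.
Qed.

(** The pairing of a round depends on the earlier paths, hence the hypothesis for every [m]. After i
    rounds signature classes have at most 2^(k-i) vertices, so k rounds leave singletons. *)
Lemma has_sps_of_transversals k : n <= 2 ^ k ->
  (forall m : 'I_n -> 'I_n, involutive m ->
     exists x p, [/\ path (adj g) x p, uniq (x :: p) &
       forall v, m v != v -> (m v \in x :: p) = (v \notin x :: p)]) ->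
  has_sps g k.
Proof.
move=> nk hT.
have key i : i <= k -> exists F : seq {set 'I_n}, [/\ size F = i, all (is_path_set g) F &
    forall v, #|[set u | signature F u == signature F v]| <= 2 ^ (k - i)].
  elim: i => [_|i IH ik].
    exists [::]; split=> // v; rewrite subn0; apply: leq_trans (max_card _) _; by rewrite card_ord.
  have [F [sF aF hF]] := IH (ltnW ik).
  have [m [mK sm mfix]] := exists_pairing (signature F).
  have [x [p [hp hu hm]]] := hT m mK.
  have [T eT] : exists T, T = [set z in x :: p] by eexists.
  have hmT v : m v != v -> (m v \in T) = (v \notin T) by rewrite eT !inE; exact: hm.
  exists (T :: F); split; rewrite /= ?sF ?aF ?eT ?path_setI // -eT.
  move=> v; pose C := [set u | signature F u == signature F v].
  have cC : #|C| <= 2 ^ (k - i.+1).+1 by rewrite -subSn // subSS; apply: hF.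
  have [] := @class_half C T m (k - i.+1) mK _ hmT _ cC.
  - by move=> u; rewrite !inE sm.
  - by move=> u w; rewrite !inE => /eqP h1 /eqP h2; apply: mfix; rewrite h1 h2.
  case vT : (v \in T) => h1 h2; [apply: leq_trans h1|apply: leq_trans h2]; apply: subset_leq_card;
    by apply/subsetP=> u; rewrite !inE eqseq_cons => /andP[/eqP-> ->].
have [F [sF aF hF]] := key k (leqnn _).
have szF : size F == k by rewrite sF.
apply/existsP; exists (Tuple szF); rewrite aF /=.
apply/forallP=> u; apply/forallP=> v; apply/implyP; apply: contraNT => /hasPn h.
have := hF v; rewrite subnn expn0 => /card_le1P h1.
have hu : signature F u == signature F v.
  by apply/eqP/eq_in_map => S /h; rewrite negbK => /eqP.
have vv : v \in [set u | signature F u == signature F v] by rewrite inE.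
by have := h1 v vv u; rewrite !inE hu => /esym.
Qed.

Lemma has_sps_bound k : has_sps g k -> n <= 2 ^ k.
Proof.
case/existsP=> F /andP[_ /forallP hF].
have szs v : size (signature F v) == k by rewrite size_map size_tuple.
pose f v := Tuple (szs v).
have fi : injective f.
  move=> u v e; apply/eqP; apply: contraT => uv.
  have := forallP (hF u) v; rewrite uv => /hasP[S SF];
    have := congr1 val e => /= /eq_in_map /(_ S SF) ->.
  by rewrite eqxx.
by have := leq_card f fi; rewrite card_ord card_tuple card_bool.
Qed.

Lemma sp_eq_up_log : has_sps g (up_log 2 n) -> sp_eq g (up_log 2 n).
Proof.
move=> h; rewrite /sp_eq h /=; apply/forallP=> k; apply/negP=> /has_sps_bound hk.
by have := up_log_min (isT : 1 < 2) hk; have := ltn_ord k; lia.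
Qed.
End Separate.

(** * Existence of regular graphs *)

Lemma cayley_regular n (S : {set 'I_n.+1}) : 0%R \notin S ->
  (forall x, x \in S -> (- x)%R \in S) ->
  regular #|S| [ffun p : 'I_n.+1 * 'I_n.+1 => (p.2 - p.1)%R \in S].
Proof.
move=> S0 SN; apply/andP; split.
  apply/andP; split; apply/forallP=> x; first by rewrite /adj ffunE subrr.
  apply/forallP=> y; rewrite /adj !ffunE /=; apply/eqP.
  by apply/idP/idP=> /SN; rewrite opprB.
apply/forallP=> x; rewrite -(card_imset (mem S) (addIr x)); apply/eqP/eq_card=> y.
rewrite inE /adj ffunE /=; apply/idP/imsetP => [h|[z zS ->]]; last by rewrite addrK.
by exists (y - x)%R; rewrite ?subrK.
Qed.

(** Needed because [prob_reg] would be 0/0 = 0 otherwise. The graph is circulant with differences 1,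
    ..., h and their negatives; for odd d the number of vertices is even and its half is added as a
    self-inverse difference. *)
Lemma reg_graphs_gt0 n d : d < n -> ~~ odd (d * n) -> 0 < #|reg_graphs n d|.
Proof.
case: n => // n dn hodd.
suff [S [S0 SN <-]] : exists S : {set 'I_n.+1}, [/\ 0%R \notin S, forall x, x \in S -> (- x)%R
  \in S & #|S| = d].
  by rewrite card_gt0; apply/set0Pn; eexists; rewrite inE; apply: cayley_regular.
have hd := odd_double_half d; set h := d./2 in hd; clearbody h.
pose A := [set (inord (nat_of_ord i).+1 : 'I_n.+1) | i : 'I_h].
have hn : 2 * h < n.+1 by rewrite -mul2n in hd; lia.
have valA x : x \in A -> 0 < x <= h.
  by case/imsetP=> i _ ->; rewrite inordK; have := ltn_ord i; lia.
have valN (x : 'I_n.+1) : 0 < x -> nat_of_ord (- x)%R = n.+1 - x.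
  by move=> x0; rewrite /= modn_small //; have := ltn_ord x; lia.
have cA : #|A| = h.
  rewrite card_imset ?card_ord // => i j /(congr1 (@nat_of_ord _)).
  rewrite !inordK; [|have := ltn_ord j; lia|have := ltn_ord i; lia].
  by move=> [] /ord_inj.
pose B := [set (- x)%R | x in A].
have cB : #|B| = h by rewrite card_imset //; apply: oppr_inj.
have dAB : [disjoint A & B].
  apply/pred0P=> x /=; apply/negP=> /andP[/valA xA /imsetP[y /valA yA e]].
  by move: xA; rewrite e valN; have := ltn_ord y; lia.
have S0 : (0 : 'I_n.+1)%R \notin A :|: B.
  apply/negP; rewrite inE => /orP[/valA //|/imsetP[y /valA yA /(congr1 (@nat_of_ord _))]].
  by rewrite valN /=; have := ltn_ord y; lia.
have SN x : x \in A :|: B -> (- x)%R \in A :|: B.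
  rewrite !inE => /orP[xA|/imsetP[y yA ->]]; first by rewrite (imset_f _ xA) orbT.
  by rewrite opprK yA.
have cAB : #|A :|: B| = 2 * h.
  by rewrite cardsU (disjoint_setI0 dAB) cards0 subn0 cA cB mul2n addnn.
case: (boolP (odd d)) hd => /= od hd; last by exists (A :|: B); split; rewrite // cAB mul2n.
have en : ~~ odd n.+1 by move: hodd; rewrite oddM od.
have hk : n.+1 = 2 * n.+1./2 by rewrite -[LHS]odd_double_half (negbTE en) mul2n.
have lk : n.+1./2 < n.+1 by lia.
pose k : 'I_n.+1 := Ordinal lk.
have kN : (- k)%R = k by apply/ord_inj; rewrite valN /=; lia.
have kA : k \notin A :|: B.
  apply/negP; rewrite inE => /orP[/valA /=|/imsetP[y /valA yA /(congr1 (@nat_of_ord _))]];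
    first lia.
  by rewrite valN /=; lia.
exists (k |: (A :|: B)); split.
- by rewrite in_setU1 negb_or S0 andbT; apply/eqP=> /(congr1 (@nat_of_ord _)) /=; lia.
- by move=> x; rewrite !in_setU1 => /orP[/eqP->|/SN ->]; rewrite ?kN ?eqxx ?orbT.
- by rewrite cardsU1 kA cAB; lia.
Qed.

(** * The theorem *)

(* K is the order of d / r, where 6r is the degree of the sparse subgraph; sets of
   size at least n / h are joined; 4^(-krn) bounds the probability that a fixed
   quadratic set of pairs is avoided. *)
Definition admissible K h k :=
  [&& 1024 * 7 <= K, 4096 * k <= K, (8 * K) ^ 7 * 4 <= 4 ^ k, 96 * K <= h & 16 < h].

(** The values enter through equations and exponents are compared, so 2^26 is never unfolded in
    unary. First k = 2^7 makes (2^22)^7 * 4 = 2^156 smaller than 4^k = 2^256; then K = 4096k and h =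
    2^7 K. *)
Lemma admissible_powers K h k : K = 2 ^ 19 -> h = 2 ^ 26 -> k = 2 ^ 7 -> admissible K h k.
Proof.
move=> eK eh ek.
have le2 x y : x <= y -> 2 ^ x <= 2 ^ y by move=> xy; rewrite leq_exp2l.
apply/and5P; split.
- have e : 1024 * 7 <= 2 ^ 10 * 2 ^ 3 by rewrite leq_mul.
  rewrite eK. refine (leq_trans e _). rewrite -expnD. refine (le2 (10 + 3) 19 isT).
- have -> : 4096 = 2 ^ 12 by vm_compute.
  rewrite eK ek -expnD. refine (le2 (12 + 7) 19 isT).
- have e : 2 ^ 3 * K = 2 ^ 22 by rewrite eK -expnD; reflexivity.
  rewrite -[8]/(2 ^ 3) e.
  rewrite ek -[4]/(2 ^ 2) -!expnM -expnD. refine (le2 (22 * 7 + 2) (2 * 2 ^ 7) isT).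
- have e : 96 * K <= 2 ^ 7 * K by rewrite leq_mul2r orbT.
  rewrite eh. refine (leq_trans e _). rewrite eK -expnD. refine (le2 (7 + 19) 26 isT).
- have e : 16 < 2 ^ 5 by [].
  rewrite eh. refine (leq_trans e _). refine (le2 5 26 isT).
Qed.

Lemma admissible_exists : exists K h k, admissible K h k.
Proof.
refine (ex_intro _ _ (ex_intro _ _ (ex_intro _ _ _))).
exact (admissible_powers erefl erefl erefl).
Qed.

(** With a = d / 16 rounded down, d <= 16 * 2^a, and 2^11 * 4^a <= 8^a once a >= 11, that is, from d
    = 176 on. *)
Lemma sq_le_exp8 d : 176 <= d -> 8 * d ^ 2 <= 8 ^ (d %/ 16).
Proof.
move=> hd; set a := d %/ 16.
have ha : 11 <= a by rewrite leq_divRL.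
have da : d <= 16 * 2 ^ a.
  have := ltn_ceil d (isT : 0 < 16); rewrite -/a; have := ltn_expl a (isT : 1 < 2); lia.
apply: leq_trans (_ : 8 * (16 * 2 ^ a) ^ 2 <= _); first by rewrite leq_mul2l leq_exp2r.
have -> : 8 ^ a = 2 ^ a * (2 ^ a) ^ 2 by rewrite -!expnM -expnD (_ : 8 = 2 ^ 3) // -expnM;
  congr (_ ^ _); lia.
rewrite expnMn mulnA leq_mul2r; apply/orP; right.
by apply: leq_trans (_ : 2 ^ 11 <= _); rewrite ?leq_exp2l.
Qed.

(** Up to rounding, r = d/K, a = d/16, i = dn / (128 h^2), and q = 64 h^2. The lower bound on d
    makes r exceed 3q + 1 and 128K. The exponentially unlikely events contribute 1 each to 32K +
    2. *)
Lemma bad_graphs K h k n d : admissible K h k -> K * (256 * h ^ 2 + 128 * K + 200) <= d ->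
  8 * h ^ 2 * d + 512 * d + 8 <= n -> 
  #|[set g in reg_graphs n d | ~~ sp_eq g (up_log 2 n)]| * n <= #|reg_graphs n d| * (32 * K + 2).
Proof.
case/and5P=> hK1 hK2 hK3 hh1 hh2 hd hn.
have K0 : 0 < K by apply: leq_trans hK1.
set r := d %/ K.
have hr : 256 * h ^ 2 + 128 * K + 200 <= r by rewrite leq_divRL // mulnC.
have rK : r * K <= d by apply: leq_trunc_div.
have r200 : 200 <= r by apply: leq_trans (leq_addl _ _) hr.
have rK2 : 128 * K <= r - 2 by move: hr; clear; lia.
have rh : 256 * h ^ 2 <= r by move: hr; clear; lia.
have r0 : 0 < r by apply: leq_trans r200.
have dK : d <= 2 * K * r.
  have := ltn_ceil d K0; rewrite -/r mulSn => /ltnW h1; apply: leq_trans h1 _.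
  by rewrite -mulnA mul2n -addnn mulnC leq_add2r leq_pmulr.
have rd : r <= d by apply: leq_trans rK; rewrite leq_pmulr.
have d0 : 0 < d by apply: leq_trans rd.
have h2 : 0 < h ^ 2 by rewrite expn_gt0; apply/orP; left; apply: leq_trans hh2.
have h0 : 0 < 128 * h ^ 2 by rewrite muln_gt0.
set r2 := d %/ (128 * h ^ 2).
have hr2 : 2 <= r2 by rewrite leq_divRL // mulnA; apply: leq_trans rd.
have r2d : 128 * h ^ 2 * r2 <= d by rewrite mulnC; apply: leq_trunc_div.
have dr2 : d <= 256 * h ^ 2 * r2.
  have := ltn_ceil d h0; rewrite -/r2 mulSn => /ltnW h1; apply: leq_trans h1 _.
  by move: hr2; clear; nia.
have hn8 : 8 * h ^ 2 * d <= n by apply: leq_trans hn; rewrite -addnA leq_addr.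
have hn5 : 512 * d + 8 <= n by apply: leq_trans hn; rewrite -addnA leq_addl.
have n8 : 7 < n by apply: leq_trans hn5; apply: leq_addl.
have hnd : 8 * (d + 1) <= n by move: hn5 d0; clear; lia.
have hnd' : 512 * d <= n by apply: leq_trans hn5; apply: leq_addr.
have n0 : 0 < n by apply: leq_trans n8.
have e1 : #|[set g in reg_graphs n d | ~~ sparse_small r K g]| * n <= #|reg_graphs n d| * (32 * K).
  apply: event_sparse => //; first by apply: leq_trans r200.
  by apply: leq_trans rK2 _; apply/ltnW/ltn_expl.
have e2 : #|[set g in reg_graphs n d | ~~ joined h (4 * (r2 * n)) g]| * 4 ^ n <= #|reg_graphs n d|.
  apply: event_joined => //; last by rewrite leq_mul2r hr2 orbT.
  by rewrite mulnA [n * d]mulnC leq_mul2r r2d orbT.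
have birr F (T : {set 'I_n}) (x : 'I_n) : (x, x) \notin boosters F T by rewrite inE eqxx.
have e3 := event_boosters birr n0 d0 r0 hnd hnd' rK dK hK1 hK2 hK3.
set b1 := #|_| in e1; set b2 := #|_| in e2; set b3 := #|_| in e3.
have hb : #|[set g in reg_graphs n d | ~~ sp_eq g (up_log 2 n)]| <= b1 + b2 + b3.
  pose B1 := [set g in reg_graphs n d | ~~ sparse_small r K g].
  pose B2 := [set g in reg_graphs n d | ~~ joined h (4 * (r2 * n)) g].
  pose B3 := [set g in reg_graphs n d | ~~ meets_boosters (7 * (r * n)) (@boosters n) g].
  apply: leq_trans (_ : #|B1 :|: B2 :|: B3| <= _); last first.
    apply: leq_trans (leq_card_setU _ _) _; rewrite leq_add2r; exact: leq_card_setU.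
  apply: subset_leq_card; apply/subsetP=> g; rewrite !inE => /andP[gr].
  rewrite gr /=; apply: contraNT; rewrite !negb_or !negbK => /andP[/andP[hs hj] hB].
  apply: sp_eq_up_log; apply: has_sps_of_transversals; first by apply: up_logP.
  move=> m mK; have hd16 : 176 <= d by apply: leq_trans rd; apply: leq_trans r200.
  apply: (@transversal_path n d g gr m r K h (r2 * n) (d %/ 16) (64 * h ^ 2)) => //.
  - by rewrite muln_gt0.
  - rewrite leq_divRL //; apply: leq_trans rK; rewrite mulnC mulnA mulnC leq_mul2l.
    by apply/orP; right; apply: leq_trans hK1.
  - by rewrite mulnC; apply: leq_trunc_div.
  - exact: sq_le_exp8.
  - rewrite mulnC [4 * _]mulnA mulnA leq_mul2r; apply/orP; right.
    by apply: leq_trans dr2 _; move: (h ^ 2) (r2); clear; lia.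
  - by move: rh r200; move: (h ^ 2); clear; lia.
have p2 : n <= 2 ^ n by apply/ltnW/ltn_expl.
have p4 : n <= 4 ^ n by apply/ltnW/ltn_expl.
apply: leq_trans (_ : (b1 + b2 + b3) * n <= _); first by rewrite leq_mul2r hb orbT.
have := leq_mul (leqnn b2) p4; have := leq_mul (leqnn b3) p2; lia.
Qed.

Theorem theorem1p3 :
  exists D : nat, (1 <= D)%N /\
    forall d : nat, (D <= d)%N ->
      forall eps : rat, (0 < eps)%R ->
        exists N : nat, forall n : nat, (N <= n)%N -> ~~ odd (d * n) ->
          (1 - eps < prob_reg n d (fun g => sp_eq g (up_log 2 n)))%R.
Proof.
have [K [h [k adm]]] := admissible_exists.
exists (K * (256 * h ^ 2 + 128 * K + 200)).+1; split=> // d hd eps eps0.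
(* For n > c the failure bound (32K + 2)/n is below eps. *)
pose c : rat := ((32 * K + 2)%:R / eps)%R.
exists (8 * h ^ 2 * d + 512 * d + 8 + Num.bound c) => n hn hodd.
have hbad := bad_graphs adm (ltnW hd) (leq_trans (leq_addr _ _) hn).
have M0 : 0 < #|reg_graphs n d| by apply: reg_graphs_gt0 => //; lia.
rewrite /prob_reg ltr_pdivlMr ?ltr0n //.
set M := #|reg_graphs n d| in hbad M0 *.
set good := #|_|; set bad := #|_| in hbad.
have gb : M = good + bad.
  rewrite /M -(cardsID [set g | sp_eq g (up_log 2 n)] (reg_graphs n d)); congr (_ + _);
    apply: eq_card => g; rewrite !inE // andbC //.
have n0 : 0 < n by lia.
have hc : (c < n%:R)%R.
  have c0 : (0 <= c)%R by rewrite divr_ge0 ?ler0n // ltW.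
  by apply: lt_le_trans (archi_boundP c0) _; rewrite ler_nat; apply: leq_trans hn; apply: leq_addl.
rewrite mulrBl mul1r ltrBlDr gb natrD ltrD2l -natrD -gb.
rewrite -(ltr_pM2r (_ : 0 < n%:R)%R) ?ltr0n //.
apply: (@le_lt_trans _ _ (M * (32 * K + 2))%:R%R); first by rewrite -natrM ler_nat.
move: hc; rewrite /c ltr_pdivrMr // => hc.
rewrite natrM [(eps * _)%R]mulrC -mulrA ltr_pM2l ?ltr0n //.
by rewrite mulrC.
Qed.
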